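(* Consider the affine-in-control randomly switched system $$\dot x=f_\sigma(x,d)+\sum_{i=1}^m g_{\sigma,i}(x)u_i,\qquad x(0)=x_0,\quad t\ge0,$$ with control set $\mathcal C=\mathbb R^m$. Suppose that $\sigma$ belongs to class UH, with parameters $T>0$ and $q_j\in\,]0,1[$, $j\in\mathcal P$, and that there are continuously differentiable functions $V_j:\mathbb R^n\to\mathbb R_{\ge0}$, $j\in\mathcal P$, such that: (Cd1) there exist $\alpha_1,\alpha_2\in\mathcal K_\infty$ with $\alpha_1(\|x\|)\le V_j(x)\le\alpha_2(\|x\|)$ for all $j\in\mathcal P$, $x\in\mathbb R^n$; (Cd2) there exists $\mu\ge1$ with $V_i(x)\le\mu V_j(x)$ for all $i,j\in\mathcal P$, $x\in\mathbb R^n$; (Cd3) there exist $\chi\in\mathcal K_\infty$ and $\lambda_j\in\mathbb R$, $j\in\mathcal P$, such that for all $x\in\mathbb R^n\setminus\{0\}$, all $d\in\mathbb R^k$ and all $j\in\mathcal P$, $$\inf_{u\in\mathcal C}\left\{\frac{\partial V_j}{\partial x}(x)f_j(x,d)+3\lambda_jV_j(x)+\sum_{i=1}^m\mathrm L_{g_{j,i}}V_j(x)\,u_i\right\}\le\chi(\|d\|);$$ (Cd4) for every $\varepsilon>0$ there is $\delta>0$ such that if $x\ne0$ satisfies $\|x\|<\delta$, then there is $u\in\mathbb R^m$ with $\|u\|<\varepsilon$ such that for all $j\in\mathcal P$, $$\max_{d\in\mathbb R^k}\left\{\frac{\partial V_j}{\partial x}(x)f_j(x,d)-\chi(\|d\|)\right\}+\sum_{i=1}^m\mathrm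 L_{g_{j,i}}V_j(x)\,u_i\le-\lambda_jV_j(x);$$ (Cd5) $\displaystyle\sum_{j\in\mathcal P}\frac{\mu q_j\bigl(1-e^{-\lambda_jT}\bigr)}{\lambda_jT}<1$. For each $j\in\mathcal P$ let $\widetilde W_j(x):=\bigl[\mathrm L_{g_{j,1}}V_j(x),\ldots,\mathrm L_{g_{j,m}}V_j(x)\bigr]$ and let $\overline W_j:\mathbb R^n\to\mathbb R$ be a map that is smooth away from $0$, continuous at $0$, and satisfies, for all $x\in\mathbb R^n$, $$\max_{d\in\mathbb R^k}\left\{\frac{\partial V_j}{\partial x}(x)f_j(x,d)-\chi(\|d\|)\right\}+\lambda_jV_j(x)\le\overline W_j(x)\le\max_{d\in\mathbb R^k}\left\{\frac{\partial V_j}{\partial x}(x)f_j(x,d)-\chi(\|d\|)\right\}+2\lambda_jV_j(x).$$ Let $\varphi:\mathbb R\times\mathbb R^m\to\mathbb R^m$ be given by $\varphi(a,b):=-\dfrac{a+\sqrt{a^2+\|b\|^4}}{\|b\|^2}\,b$ if $b\ne0$ and $\varphi(a,0):=0$. Then under the feedback control function $k_\sigma(x)=\varphi\bigl(\overline W_\sigma(x),\widetilde W_\sigma(x)^{\mathrm T}\bigr)$ the closed-loop system $$\dot x=f_\sigma(x,d)+\sum_{i=1}^m g_{\sigma,i}(x)k_{\sigma,i}(x),\qquad x(0)=x_0,\quad t\ge0,$$ satisfies an ISS in $L_1$ estimate at switching instants.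
   Context: Notation: $\mathbb N=\{1,2,\ldots\}$; $\mathbb R_{\ge 0}=[0,\infty[$; $\|\cdot\|$ is the Euclidean norm; $\|d\|_{A}$ is the essential supremum norm of $d$ on $A\subseteq\mathbb R_{\ge0}$; $\mathrm L_gV(x)=\frac{\partial V}{\partial x}(x)g(x)$ is the Lie derivative. A function $\alpha:\mathbb R_{\ge0}\to\mathbb R_{\ge0}$ is in class $\mathcal K$ if it is (strictly) increasing, continuous and $\alpha(0)=0$; it is in class $\mathcal K_\infty$ if in addition it is unbounded. A function $\beta:\mathbb R_{\ge0}^2\to\mathbb R_{\ge0}$ is in class $\mathcal{KL}$ if $\beta(\cdot,s)\in\mathcal K$ for each $s$ and $\beta(r,s)\searrow 0$ as $s\to\infty$ for each $r$. For $\lambda_j=0$ the quotient $(1-e^{-\lambda_jT})/(\lambda_jT)$ is understood as its limit $1$. The maxima over $d\in\mathbb R^k$ are understood to exist (as finite numbers). Setting: $(\Omega,\mathfrak F,\mathsf P)$ is a probability space. $\mathcal P=\{1,\ldots,\mathrm N\}$ is a finite index set; $f_j:\mathbb R^n\times\mathbb R^k\to\mathbb R^n$ and $g_{j,i}:\mathbb R^n\to\mathbb R^n$ are smooth for $j\in\mathcal P$, $i\in\{1,\ldots,m\}$; $u_1,\ldots,u_m$ are scalar controls and $u=[u_1,\ldots,u_m]^{\mathrm T}\in\mathcal C$; $k_{\sigma,i}$ denotes the $i$-th component of $k_\sigma$. The disturbance $d:\mathbb R_{\ge0}\to\mathbb R^k$ is a deterministic function of time. Initial conditions satisfy $x_0\ne0$.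 A random switching signal $\sigma$ is a càdlàg stochastic process with values in $\mathcal P$ such that for each $t\ge0$ and $\omega\in\Omega$ there is $\epsilon(t,\omega)>0$ with $\sigma(t+s,\omega)=\sigma(t,\omega)$ for $s\in[0,\epsilon(t,\omega)[$. Its switching instants are $0=\tau_0\le\tau_1\le\tau_2\le\cdots$, with $\sigma$ constant on each $[\tau_i,\tau_{i+1}[$ (consecutive values are allowed to coincide). Solutions are stochastic processes with locally absolutely continuous paths satisfying the differential equation for almost every $t$. Class UH: let $S_i:=\tau_i-\tau_{i-1}$, $i\in\mathbb N$, be the holding times. $\sigma$ belongs to class UH if (UH1) $(S_i)_{i\in\mathbb N}$ are i.i.d. random variables uniformly distributed on $[0,T]$ for some $T>0$; (UH2) $(\sigma(\tau_i))_{i\in\mathbb N\cup\{0\}}$ is i.i.d. with $\mathsf P(\sigma(\tau_i)=j)=q_j$ for some $q_j\in\,]0,1[$, $j\in\mathcal P$; (UH3) the sequences $(S_i)_{i\in\mathbb N}$ and $(\sigma(\tau_i))_{i\in\mathbb N}$ are mutually independent. ISS in $L_1$ estimate at switching instants: the closed-loop system satisfies such an estimate if there exist $\beta\in\mathcal{KL}$ and $\alpha,\gamma\in\mathcal K_\infty$ such that for every initial condition $x_0$ and every measurable essentially bounded $d$, $$\mathsf E\bigl[\alpha(\|x(\tau_\nu)\|)\bigr]\le\beta(\|x_0\|,\nu)+\gamma\bigl(\|d\|_{\mathbb R_{\ge0}}\bigr)$$ for all $\nu\in\mathbb N$ along solutions of the closed-loop system. *)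

(* Defs.v *)
From HB Require Import structures.
From mathcomp Require Export all_boot all_order all_algebra.
From mathcomp Require Export finmap.
From mathcomp Require Export all_classical all_reals all_analysis ess_sup_inf.
Export Order.TTheory GRing.Theory Num.Theory.
Export numFieldNormedType.Exports.

Set Implicit Arguments.
Unset Strict Implicit.
Unset Printing Implicit Defensive.

Local Open Scope classical_set_scope.
Local Open Scope ring_scope.

(* Vectors of R^n are row vectors; the library norm on 'rV[R]_n is the max
   norm, hence this definition. *)
Definition enorm (R : realType) (n : nat) (x : 'rV[R]_n) : R :=
  Num.sqrt (\sum_(i < n) x ord0 i ^+ 2).

(* Functions on [0, +oo[ are represented by functions on R whose values on
   negative reals are irrelevant. *)
Definition class_K (R : realType) (alpha : R -> R) : Prop :=
  [/\ forall r, 0 <= r -> 0 <= alpha r,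
      {in `[0, +oo[ &, {homo alpha : r s / r < s}},
      {within `[0, +oo[%classic, continuous alpha} &
      alpha 0 = 0].

Definition class_Koo (R : realType) (alpha : R -> R) : Prop :=
  class_K alpha /\ forall M, exists2 r, 0 <= r & M < alpha r.

Definition class_KL (R : realType) (beta : R -> R -> R) : Prop :=
  (forall s, 0 <= s -> class_K (beta ^~ s)) /\
  (forall r, 0 <= r ->
     {in `[0, +oo[ &, {homo beta r : s t / s <= t >-> t <= s}} /\
     beta r s @[s --> +oo] --> (0 : R)).

(* C^p on the open set U, through iterated differentials. *)
Fixpoint Ck_on (R : realType) (E F : normedModType R) (p : nat) (U : set E)
    (f : E -> F) : Prop :=
  match p with
  | 0 => forall x, U x -> {for x, continuous f}
  | p.+1 => (forall x, U x -> differentiable f x) /\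
            forall v : E, Ck_on p U (fun x => 'd f x v)
  end.

Definition smooth_on (R : realType) (E F : normedModType R) (U : set E)
    (f : E -> F) : Prop :=
  forall p, Ck_on p U f.

Definition lie_derivative (R : realType) (n : nat) (g : 'rV[R]_n -> 'rV[R]_n)
    (V : 'rV[R]_n -> R) (x : 'rV[R]_n) : R :=
  'd V x (g x).

Definition has_max_value (R : realType) (T : Type) (h : T -> R) : Prop :=
  exists d0, forall d, h d <= h d0.

(* This is the maximum of h under has_max_value h. *)
Definition max_value (R : realType) (T : Type) (h : T -> R) : R :=
  sup (range h).

Definition sontag (R : realType) (m : nat) (a : R) (b : 'rV[R]_m) : 'rV[R]_m :=
  if b == 0 then 0
  else - ((a + Num.sqrt (a ^+ 2 + enorm b ^+ 4)) / enorm b ^+ 2) *: b.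

(* (1 - e^(-l T)) / (l T), extended by its limit 1 at l = 0. *)
Definition mean_decay (R : realType) (l T : R) : R :=
  if l == 0 then 1 else (1 - expR (- (l * T))) / (l * T).

Definition affine_dynamics (R : realType) (N n k m : nat)
    (f : 'I_N -> 'rV[R]_n -> 'rV[R]_k -> 'rV[R]_n)
    (g : 'I_N -> 'I_m -> 'rV[R]_n -> 'rV[R]_n)
    (j : 'I_N) (x : 'rV[R]_n) (d : 'rV[R]_k) (u : 'rV[R]_m) : 'rV[R]_n :=
  f j x d + \sum_(i < m) u ord0 i *: g j i x.

Definition mutually_independent (R : realType) (dO : measure_display)
    (Omega : measurableType dO) (P : probability Omega R)
    (I : choiceType) (F : I -> set (set Omega)) : Prop :=
  forall (J : {fset I}) (A : I -> set Omega),
    (forall i, i \in J -> F i (A i)) ->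
    P (\bigcap_(i in [set` J]) A i) = (\prod_(i <- J) P (A i))%E.

Definition independent_systems (R : realType) (dO : measure_display)
    (Omega : measurableType dO) (P : probability Omega R)
    (F G : set (set Omega)) : Prop :=
  forall A B, F A -> G B -> P (A `&` B) = (P A * P B)%E.

(* A cadlag path with values in the (discrete) set 'I_N has left limits in the
   sense of being constant on some ]t - e, t[; right-continuity is the
   requirement that it be constant on some [t, t + eps[. *)
Definition random_switching_signal (R : realType) (dO : measure_display)
    (Omega : measurableType dO) (N : nat) (sigma : R -> Omega -> 'I_N) : Prop :=
  [/\ forall t j, 0 <= t -> measurable [set w | sigma t w = j],
      forall t w, 0 <= t -> exists2 eps : R, 0 < eps &
        forall s, 0 <= s < eps -> sigma (t + s) w = sigma t w &
      forall t w, 0 < t -> exists j, \forall s \near t^'-, sigma s w = j].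

Definition switching_instants (R : realType) (dO : measure_display)
    (Omega : measurableType dO) (N : nat) (sigma : R -> Omega -> 'I_N)
    (tau : nat -> Omega -> R) : Prop :=
  [/\ forall i, measurable_fun setT (tau i),
      forall w, tau 0%N w = 0,
      forall i w, tau i w <= tau i.+1 w &
      forall i w t, tau i w <= t < tau i.+1 w -> sigma t w = sigma (tau i w) w].

(* holding_time tau i is S_(i+1): the holding times are numbered from 1. *)
Definition holding_time (R : realType) (Omega : Type) (tau : nat -> Omega -> R)
    (i : nat) (w : Omega) : R :=
  tau i.+1 w - tau i w.

Definition switched_value (R : realType) (Omega : Type) (N : nat)
    (sigma : R -> Omega -> 'I_N) (tau : nat -> Omega -> R)
    (i : nat) (w : Omega) : 'I_N :=
  sigma (tau i w) w.

Definition sigma_of_holding (R : realType) (dO : measure_display)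
    (Omega : measurableType dO) (tau : nat -> Omega -> R) (i : nat) :
    set (set Omega) :=
  preimage_set_system setT (holding_time tau i) measurable.

Definition sigma_of_value (R : realType) (Omega : Type) (N : nat)
    (sigma : R -> Omega -> 'I_N) (tau : nat -> Omega -> R) (i : nat) :
    set (set Omega) :=
  preimage_set_system setT (switched_value sigma tau i) setT.

(* The values sigma(tau_i), i >= 0, are i.i.d., but only those with i >= 1 are
   required to be independent of the holding times. *)
Record class_UH (R : realType) (dO : measure_display)
    (Omega : measurableType dO) (P : probability Omega R) (N : nat)
    (sigma : R -> Omega -> 'I_N) (tau : nat -> Omega -> R)
    (T : R) (q : 'I_N -> R) : Prop := ClassUH {
  UH_T_gt0 : 0 < T ;
  UH_q_itv : forall j, 0 < q j < 1 ;
  UH1_independent : mutually_independent P (sigma_of_holding tau) ;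
  UH1_uniform : forall i A, measurable A ->
    P (holding_time tau i @^-1` A) = uniform_prob UH_T_gt0 A ;
  UH2_measurable : forall i j,
    measurable [set w | switched_value sigma tau i w = j] ;
  UH2_independent : mutually_independent P (sigma_of_value sigma tau) ;
  UH2_law : forall i j,
    P [set w | switched_value sigma tau i w = j] = (q j)%:E ;
  UH3 : independent_systems P
    <<s \bigcup_i sigma_of_holding tau i >>
    <<s \bigcup_(i in [set i | (0 < i)%N]) sigma_of_value sigma tau i >>
}.

Definition absolutely_continuous (R : realType) (n : nat) (a b : R)
    (f : R -> 'rV[R]_n) : Prop :=
  forall eps : R, 0 < eps -> exists2 delta : R, 0 < delta &
    forall (p : nat) (s t : 'I_p -> R),
      (forall i, [/\ a <= s i, s i <= t i & t i <= b]) ->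
      trivIset setT (fun i => `]s i, t i[%classic) ->
      \sum_(i < p) (t i - s i) < delta ->
      \sum_(i < p) enorm (f (t i) - f (s i)) < eps.

Definition locally_absolutely_continuous (R : realType) (n : nat)
    (f : R -> 'rV[R]_n) : Prop :=
  forall a b, 0 <= a -> a <= b -> absolutely_continuous a b f.

Definition is_solution (R : realType) (dO : measure_display)
    (Omega : measurableType dO) (N n k : nat) (sigma : R -> Omega -> 'I_N)
    (F : 'I_N -> 'rV[R]_n -> 'rV[R]_k -> 'rV[R]_n)
    (d : R -> 'rV[R]_k) (x0 : 'rV[R]_n) (x : R -> Omega -> 'rV[R]_n) : Prop :=
  [/\ forall t i, 0 <= t -> measurable_fun setT (fun w => x t w ord0 i),
      forall w, x 0 w = x0,
      forall w, locally_absolutely_continuous (x ^~ w) &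
      forall w, {ae (@lebesgue_measure R), forall t : R, 0 <= t ->
        is_derive t 1 (x ^~ w) (F (sigma t w) (x t w) (d t))}].

(* Extending the norm of d by 0 outside A does not change the essential
   supremum over A, as norms are nonnegative. *)
Definition ess_sup_norm (R : realType) (k : nat) (A : set R)
    (d : R -> 'rV[R]_k) : \bar R :=
  ess_sup (@lebesgue_measure R) ((fun t => (enorm (d t))%:E) \_ A).

Definition admissible_disturbance (R : realType) (k : nat)
    (d : R -> 'rV[R]_k) : Prop :=
  (forall i, measurable_fun (`[0, +oo[%classic : set R) (fun t => d t ord0 i)) /\
  (ess_sup_norm `[0%R, +oo[%classic d < +oo)%E.

Definition ISS_L1_at_switching_instants (R : realType) (dO : measure_display)
    (Omega : measurableType dO) (P : probability Omega R) (N n k : nat)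
    (sigma : R -> Omega -> 'I_N) (tau : nat -> Omega -> R)
    (F : 'I_N -> 'rV[R]_n -> 'rV[R]_k -> 'rV[R]_n) : Prop :=
  exists (beta : R -> R -> R) (alpha gamma : R -> R),
    [/\ class_KL beta, class_Koo alpha, class_Koo gamma &
    forall (x0 : 'rV[R]_n) (d : R -> 'rV[R]_k) (x : R -> Omega -> 'rV[R]_n),
      x0 != 0 -> admissible_disturbance d -> is_solution sigma F d x0 x ->
      forall nu : nat, (0 < nu)%N ->
        ('E_P[fun w => alpha (enorm (x (tau nu w) w))] <=
         (beta (enorm x0) nu%:R
          + gamma (fine (ess_sup_norm `[0%R, +oo[%classic d)))%:E)%E].

(* Main.v *)
Require Import Defs.
From mathcomp Require Import ring lra measurable_realfun.

Set Implicit Arguments.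
Unset Strict Implicit.
Unset Printing Implicit Defensive.

Local Open Scope classical_set_scope.
Local Open Scope ring_scope.

(** The feedback makes each V_j a Lyapunov function of the j-th subsystem, and
the random switching is contracting on average.

The two bounds on Wbar_j differ by lambda_j V_j, which is therefore
nonnegative; as V_j > 0 away from 0, this forces lambda_j >= 0.  When
Wtilde_j(x) != 0, Sontag's formula makes Wbar_j(x) plus its pairing with the
control nonpositive; when Wtilde_j(x) = 0 the control has no influence, and
Cd3 itself gives the decrease.  In both cases
  dV_j(x)(closed loop) <= - lambda_j V_j(x) + chi(|d|)
([sontag_dissipation]); at x = 0 this holds because V_j has a minimum there
([diff_at_min]).

A solution satisfies this inequality only at almost every time, so it has to
be integrated along an absolutely continuous path ([lyapunov_decay]).  This
rests on a gauge argument ([gauge_nonincreasing]): a function that decreases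
infinitesimally outside a null set E, and whose increments near E are
controlled by those of the path, is nonincreasing, because absolute continuity
makes the total variation of the path over a small neighbourhood of E
negligible.  Write J_i = sigma(tau_i), S_i = tau_(i+1) - tau_i,
v_i = V_(J_i)(x(tau_i)) and C = chi(Delta), with Delta the essential supremum
of |d|.  Together with Cd2, integration over a holding time gives, for every
outcome,
  v_(i+1) <= eta_i v_i + mu C S_i,   eta_i = mu exp(- lambda_(J_i) S_i).

Unrolling bounds v_nu by products of consecutive factors eta_i
([jump_recursion_bound]); the factor eta_0, which involves the value
sigma(tau_0) that need not be independent of the holding times, is bounded by
mu.  The remaining products have expectation theta^m, where theta < 1 is the sum
in Cd5 ([expectation_jump_product]): expanding over the finitely many
sequences of values reduces the claim to an event about the values times a
product of functions of single holding times, and such expectations factor by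
independence ([expectation_indic_prod]).  Summing a geometric series yields
the estimate with alpha = alpha1, beta(r, s) = mu rho^(s-1) alpha2(r) and
gamma = mu T / (1 - rho) chi for any rho < 1 with rho >= theta and rho > 0.

The holding times are bounded by T only almost surely, and the state at a
switching instant is handled as an arbitrary function of the outcome;
[integral_le_ae_majorant] compares its expectation with that of the measurable
bound. *)

(** * Functions decreasing almost everywhere along absolutely continuous paths *)

(** Cousin's lemma as an induction principle, in place of the existence of
fine tagged partitions: a property that crosses every point from left to right
at a scale depending on the point reaches b, by considering the supremum of
the points where it holds. *)
Lemma cousin_induction (R : realType) (a b : R) (Q : R -> Prop) :
  a <= b -> Q a ->
  (forall t, a <= t <= b -> exists2 r : R, 0 < r & forall s s', a <= s -> s' <= b ->
     t - r < s -> s <= t -> t <= s' -> s' < t + r -> Q s -> Q s') ->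
  Q b.
Proof.
move=> ab Qa step; pose S := [set t | a <= t <= b /\ Q t].
have Sa : S a by split => //; rewrite lexx ab.
have supS : has_sup S by split; [exists a | exists b => t [/andP[]]].
have ac : a <= sup S by exact: ub_le_sup supS.2 _ Sa.
have cb : sup S <= b by apply: ge_sup; [exists a | move=> t [/andP[]]].
have [|r r0 stepc] := step (sup S); first by rewrite ac cb.
have [s [/andP[as_ sb] Qs] cs] := sup_adherent r0 supS.
have sc : s <= sup S by apply: ub_le_sup supS.2 _ _; split => //; rewrite as_ sb.
have [cb'|bc] := ltP (sup S) b; last first.
  apply: (stepc s) => //; last by lra.
have [t [t1 t2 t3]] : exists t, [/\ sup S < t, t <= b & t < sup S + r].
  have [br|rb] := ltP b (sup S + r); first by exists b.
  by exists (sup S + r / 2); split; lra.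
have : S t.
  split; first by apply/andP; split; lra.
  by apply: (stepc s) => //; lra.
move=> /(ub_le_sup supS.2); lra.
Qed.

Lemma negligible_sub_open (R : realType) (E : set R) (eps : R) :
  (@lebesgue_measure R).-negligible E -> 0 < eps ->
  exists U : set R, [/\ open U, E `<=` U & (lebesgue_measure U < eps%:E)%E].
Proof.
move=> [A [mA A0 EA]] eps0.
have Aoo : (lebesgue_measure A < +oo)%E by rewrite A0 ltry.
have [U [oU AU Ueps]] := lebesgue_regularity_outer mA Aoo eps0.
exists U; split => //; first exact: subset_trans EA AU.
rewrite -[U](setDUK AU) measureU//.
- by rewrite [X in (X + _)%E](_ : _ = 0%E)// add0e.
- by apply: measurableD => //; exact: open_measurable.
- by rewrite setDE setICA setICr setI0.
Qed.

(** Lists of intervals ordered from left to right are the form in which the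
induction along the interval from a to b accumulates them. *)
Lemma absolutely_continuous_seq (R : realType) (n : nat) (x : R -> 'rV[R]_n)
    (a b delta eps : R) (l : seq (R * R)) :
  (forall (p : nat) (s t : 'I_p -> R),
      (forall i, [/\ a <= s i, s i <= t i & t i <= b]) ->
      trivIset setT (fun i => `]s i, t i[%classic) ->
      \sum_(i < p) (t i - s i) < delta ->
      \sum_(i < p) enorm (x (t i) - x (s i)) < eps) ->
  all (fun p => [&& a <= p.1, p.1 <= p.2 & p.2 <= b]) l ->
  pairwise (fun p q => p.2 <= q.1) l ->
  \sum_(p <- l) (p.2 - p.1) < delta ->
  \sum_(p <- l) enorm (x p.2 - x p.1) < eps.
Proof.
move=> ac /allP lab /(pairwiseP (0, 0)) lord.
rewrite !(big_nth (0, 0)) !big_mkord => ld.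
apply: ac => //.
  by move=> i; have /and3P[] := lab _ (mem_nth (0, 0) (ltn_ord i)).
have lt_disj (i j : 'I_(size l)) : (i < j)%N ->
    `](nth (0, 0) l i).1, (nth (0, 0) l i).2[%classic `&`
    `](nth (0, 0) l j).1, (nth (0, 0) l j).2[%classic = set0.
  move=> ij; have := lord i j (ltn_ord i) (ltn_ord j) ij.
  move=> ord; rewrite -subset0 => t [/=]; rewrite !in_itv/=.
  move=> /andP[_ h1] /andP[h2 _]; have := lt_trans h1 (le_lt_trans ord h2).
  by rewrite ltxx.
apply/trivIsetP => i j _ _; rewrite neq_ltn => /orP[ij|ji]; first exact: lt_disj.
by rewrite setIC; exact: lt_disj.
Qed.

(** Cousin's lemma yields a fine partition of the interval from a to b.  Its
pieces tagged outside E contribute at most eps (b - a) to h b - h a.  Those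
tagged in E lie in an open set of small measure, so absolute continuity of x
makes their total contribution of the order of eps as well. *)
Lemma gauge_nonincreasing (R : realType) (n : nat) (x : R -> 'rV[R]_n) (h : R -> R)
    (a b K : R) (E : set R) :
  a <= b -> 0 <= K -> absolutely_continuous a b x ->
  (@lebesgue_measure R).-negligible E ->
  (forall t, a <= t <= b -> ~ E t -> forall eps : R, 0 < eps ->
    exists2 r : R, 0 < r & forall s s', a <= s -> s' <= b -> t - r < s -> s <= t ->
      t <= s' -> s' < t + r -> h s' - h s <= eps * (s' - s)) ->
  (forall t, a <= t <= b -> E t ->
    exists2 r : R, 0 < r & forall s s', a <= s -> s' <= b -> t - r < s -> s <= t ->
      t <= s' -> s' < t + r ->
      h s' - h s <= K * (enorm (x s' - x s) + (s' - s))) ->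
  h b <= h a.
Proof.
move=> ab K0 acx E0 outE inE.
suff H (eps : R) : 0 < eps -> h b - h a <= eps * (b - a + K * 2).
  rewrite leNgt; apply/negP => hab.
  have c0 : 0 < b - a + K * 2 + 1 by lra.
  have := H ((h b - h a) / (b - a + K * 2 + 1)) (divr_gt0 _ c0).
  rewrite subr_gt0 => /(_ hab); rewrite mulrAC ler_pdivlMr//; nra.
move=> eps0; have [delta delta0 acd] := acx _ eps0.
have me0 : 0 < Num.min delta eps by rewrite lt_min delta0 eps0.
have [U [oU EU Ume]] := negligible_sub_open E0 me0.
have mU : measurable U by exact: open_measurable.
(* Q t: the intervals met so far that are tagged in E are listed in l; outside
   them the increase of h up to t is at most eps (t - a). *)
pose Q t := exists l : seq (R * R),
  [/\ all (fun p => [&& a <= p.1, p.1 <= p.2 & p.2 <= t]) l,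
      pairwise (fun p q => p.2 <= q.1) l,
      ((\sum_(p <- l) (p.2 - p.1))%:E <= lebesgue_measure (U `&` `[a, t[))%E &
      h t - h a <= eps * (t - a)
        + K * \sum_(p <- l) (enorm (x p.2 - x p.1) + (p.2 - p.1))].
suff [l [lab lord lU hl]] : Q b.
  have sl : \sum_(p <- l) (p.2 - p.1) < Num.min delta eps.
    rewrite -lte_fin; apply: (le_lt_trans lU); apply: le_lt_trans Ume.
    by apply: le_measure => //; apply/mem_set => //; exact: measurableI.
  have /andP[sld sle] : (\sum_(p <- l) (p.2 - p.1) < delta) &&
    (\sum_(p <- l) (p.2 - p.1) < eps) by rewrite -lt_min.
  have := absolutely_continuous_seq acd lab lord sld.
  rewrite big_split/= in hl => sx; apply: (le_trans hl).
  rewrite [leRHS]mulrDr lerD2l mulrCA mulr_natr mulr2n.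
  by rewrite ler_wpM2l// lerD// ltW.
apply: (cousin_induction ab).
  exists [::]; split => //; first by rewrite big_nil measure_ge0.
  by rewrite big_nil !subrr !mulr0 addr0.
move=> t tab; have [Et|nEt] := pselect (E t); last first.
  have [r r0 Hr] := outE t tab nEt eps eps0; exists r => // s s' as_ s'b tr st ts' s'r.
  move=> [l [lab lord lU hl]]; exists l; split => //.
  - apply: sub_all lab => p /and3P[-> -> pt]; lra.
  - apply: (le_trans lU); apply: le_measure; try by apply/mem_set; exact: measurableI.
    apply: setIS; apply: subset_itvl; rewrite bnd_simp; lra.
  - have := Hr s s' as_ s'b tr st ts' s'r; lra.
have [r1 r10 Hr1] := inE t tab Et.
have /nbhs_ballP[r2 /= r20 Ur2] : nbhs t U by apply: open_nbhs_nbhs; split; [|exact: EU].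
exists (Num.min r1 r2); first by rewrite lt_min r10.
move=> s s' as_ s'b tr st ts' s'r.
have rr1 : Num.min r1 r2 <= r1 by rewrite ge_min lexx.
have rr2 : Num.min r1 r2 <= r2 by rewrite ge_min lexx orbT.
move=> [l [lab lord lU hl]]; exists (rcons l (s, s')); split.
- rewrite all_rcons/= lexx andbT as_/= (le_trans st ts')/=.
  apply: sub_all lab => p /and3P[-> -> pt]; lra.
- rewrite pairwise_rcons lord andbT; apply/allP => p pl /=.
  by have /and3P[] := allP lab _ pl.
- rewrite big_rcons/=.
  have -> : U `&` `[a, s'[%classic = (U `&` `[a, s[%classic) `|` `[s, s'[%classic.
    apply/seteqP; split => u /=; rewrite !in_itv/=.
      move=> [Uu /andP[au us']]; rewrite au/=.
      by have [us|su] := ltP u s; [left|right; rewrite us'].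
    move=> [[Uu /andP[-> us]]|/andP[su us']]; first by split => //=; lra.
    split; last by apply/andP; split; lra.
    by apply: Ur2; rewrite /ball/= ltr_norml; apply/andP; split; lra.
  rewrite measureU//; first last.
  + rewrite -subset0 => u [[_ /=]]; rewrite !in_itv/= => /andP[_ us] /andP[su _]; lra.
  + exact: measurableI.
  rewrite EFinD leeD//.
  have := lebesgue_measure_itv `[s, s'[ => /= ->; rewrite lte_fin.
  by case: ltP => ss'; [rewrite EFinB|rewrite lee_fin subr_le0].
- rewrite big_rcons/=.
  have h1 : h s' - h s <= K * (enorm (x s' - x s) + (s' - s)).
    by apply: Hr1 => //; lra.
  have h2 : 0 <= eps * (s' - s) by apply: mulr_ge0; lra.
  rewrite mulrDr; lra.
Qed.

(** * Lyapunov decay along an absolutely continuous path *)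

Lemma enorm_ge0 (R : realType) (n : nat) (v : 'rV[R]_n) : 0 <= enorm v.
Proof. exact: sqrtr_ge0. Qed.

Lemma coord_le_enorm (R : realType) (n : nat) (v : 'rV[R]_n) (i : 'I_n) :
  `|v ord0 i| <= enorm v.
Proof.
rewrite -sqrtr_sqr ler_wsqrtr// (bigD1 i)//= lerDl.
by apply: sumr_ge0 => j _; exact: sqr_ge0.
Qed.

Lemma norm_le_enorm (R : realType) (n : nat) (v : 'rV[R]_n) : `|v| <= enorm v.
Proof.
have -> : `|v| = mx_norm v by [].
have [->|/mx_norm_neq0[[i j] /= Ev]] := eqVneq (mx_norm v) 0.
  exact: enorm_ge0.
by rewrite [leLHS]Ev (ord1 i) coord_le_enorm.
Qed.

Lemma enorm_eq0 (R : realType) (n : nat) (v : 'rV[R]_n) : enorm v = 0 -> v = 0.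
Proof.
by move=> v0; apply/normr0_eq0/eqP; rewrite eq_le normr_ge0 andbT -v0 norm_le_enorm.
Qed.

Lemma enormB (R : realType) (n : nat) (u v : 'rV[R]_n) :
  enorm (u - v) = enorm (v - u).
Proof.
by congr Num.sqrt; apply: eq_bigr => i _; rewrite !mxE -sqrrN opprB.
Qed.

Lemma is_derive_diff_comp (R : realType) (n : nat) (V : 'rV[R]_n -> R)
    (x : R -> 'rV[R]_n) (t : R) (v : 'rV[R]_n) :
  differentiable V (x t) -> is_derive t 1 x v ->
  is_derive t 1 (V \o x) ('d V (x t) v).
Proof.
move=> dV [/derivable1_diffP dx xv].
have dVx : differentiable (V \o x) t by exact: differentiable_comp.
apply: DeriveDef; first exact/derivable1_diffP.
by rewrite deriveE// diff_comp//= -(deriveE _ dx) xv.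
Qed.

Lemma is_derive_segment (R : realType) (n : nat) (z w : 'rV[R]_n) (t : R) :
  is_derive t 1 (fun u : R => z + u *: w) w.
Proof.
have d : is_diff t (cst z + ( *:%R ^~ w) : R -> 'rV[R]_n) (0 + ( *:%R ^~ w)).
  exact: is_diffD.
apply: DeriveDef; first exact/derivable1_diffP.
by rewrite deriveE// diff_val/= /GRing.add/= add0r scale1r.
Qed.

Lemma C1_differentiable (R : realType) (n : nat) (V : 'rV[R]_n -> R) y :
  Ck_on 1 setT V -> differentiable V y.
Proof. by move=> [dV _]; exact: dV. Qed.

Definition grad_norm (R : realType) (n : nat) (V : 'rV[R]_n -> R)
    (y : 'rV[R]_n) : R := \sum_(i < n) `|'d V y (delta_mx ord0 i)|.

Lemma grad_norm_continuous (R : realType) (n : nat) (V : 'rV[R]_n -> R) :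
  Ck_on 1 setT V -> continuous (grad_norm V).
Proof.
move=> [_ dVc]; apply: continuous_big => [|i _ y]; first exact: add_continuous.
exact: (cvg_norm (dVc (delta_mx ord0 i) y I)).
Qed.

Lemma diff_le_grad_norm (R : realType) (n : nat) (V : 'rV[R]_n -> R)
    (y w : 'rV[R]_n) :
  differentiable V y -> `|'d V y w| <= grad_norm V y * enorm w.
Proof.
move=> dV; rewrite [w in 'd _ _ w]row_sum_delta linear_sum/=.
apply: (le_trans (ler_norm_sum _ _ _)); rewrite mulr_suml; apply: ler_sum => i _.
by rewrite linearZ/= normrM mulrC ler_wpM2l// coord_le_enorm.
Qed.

Lemma ball_segment (R : realType) (n : nat) (y0 y z : 'rV[R]_n) (r u : R) :
  ball y0 r y -> ball y0 r z -> 0 <= u <= 1 -> ball y0 r (z + u *: (y - z)).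
Proof.
rewrite -ball_normE /= => yr zr /andP[u0 u1].
have -> : y0 - (z + u *: (y - z)) = (1 - u) *: (y0 - z) + u *: (y0 - y).
  apply/rowP => i; rewrite !mxE; ring.
apply: (le_lt_trans (ler_normD _ _)); rewrite !normrZ (ger0_norm u0).
rewrite ger0_norm ?subr_ge0//.
have [h1 h2] : `|y0 - z| <= Num.max `|y0 - z| `|y0 - y| /\
  `|y0 - y| <= Num.max `|y0 - z| `|y0 - y| by rewrite !le_max !lexx orbT.
have h3 : Num.max `|y0 - z| `|y0 - y| < r by rewrite gt_max zr yr.
nra.
Qed.

(** A bound on the gradient at y0 persists on a ball, which is convex, so the
mean value theorem applies on its segments. *)
Lemma C1_lipschitz (R : realType) (n : nat) (V : 'rV[R]_n -> R) (y0 : 'rV[R]_n)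
    (M : R) : Ck_on 1 setT V -> grad_norm V y0 < M ->
  exists2 r : R, 0 < r & forall y z, ball y0 r y -> ball y0 r z ->
    V y - V z <= M * enorm (y - z).
Proof.
move=> V1 gM.
have /nbhs_ballP[r /= r0 Hr] : \forall y \near y0, grad_norm V y < M.
  exact: (grad_norm_continuous V1 (lt_nbhsl gM)).
exists r => // y z yr zr.
pose phi u := V (z + u *: (y - z)).
have dphi (u : R) : is_derive u 1 phi ('d V (z + u *: (y - z)) (y - z)).
  apply: (is_derive_diff_comp (x := fun u => z + u *: (y - z))).
    exact: C1_differentiable.
  exact: is_derive_segment.
have [|c c01] := @MVT_segment R phi _ 0 1 ler01 (fun u _ => dphi u).
  apply: continuous_subspaceT => u; apply: differentiable_continuous.
  by apply/derivable1_diffP; exact: (@ex_derive _ _ _ _ _ _ _ (dphi u)).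
rewrite /phi scale1r scale0r addr0 subr0 mulr1 subrKC => ->.
apply: (le_trans (ler_norm _)).
apply: (le_trans (diff_le_grad_norm _ (C1_differentiable _ V1))).
rewrite in_itv/= in c01.
have gc : grad_norm V (z + c *: (y - z)) < M.
  have bc := ball_segment yr zr c01.
  exact: (Hr _ bc).
apply: ler_wpM2r; first exact: enorm_ge0.
exact: ltW.
Qed.

Lemma ac_near (R : realType) (n : nat) (x : R -> 'rV[R]_n) (a b t : R)
    (U : set 'rV[R]_n) :
  absolutely_continuous a b x -> a <= t <= b -> nbhs (x t) U ->
  exists2 r : R, 0 < r & forall s, a <= s <= b -> t - r < s -> s < t + r -> U (x s).
Proof.
move=> acx /andP[at_ tb] /nbhs_ballP[e /= e0 Ue].
have [r r0 Hr] := acx e e0; exists r => // s /andP[as_ sb] trs str.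
apply: Ue; rewrite -ball_normE/=; apply: (le_lt_trans (norm_le_enorm _)).
have one (s1 t1 : R) : a <= s1 -> s1 <= t1 -> t1 <= b -> t1 - s1 < r ->
    enorm (x t1 - x s1) < e.
  move=> h1 h2 h3 h4; have := Hr 1%N (fun=> s1) (fun=> t1); rewrite !big_ord1.
  apply => //; apply/trivIsetP => i j _ _; rewrite !ord1 eqxx//.
have [st|ts] := leP s t; first by apply: one => //; lra.
by rewrite enormB; apply: one; lra.
Qed.

(** Local bounds propagate along the interval from a to b by Cousin's lemma. *)
Lemma ac_bounded (R : realType) (n : nat) (x : R -> 'rV[R]_n) (a b : R)
    (G : 'rV[R]_n -> R) :
  a <= b -> absolutely_continuous a b x -> continuous G ->
  exists M, forall t, a <= t <= b -> G (x t) <= M.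
Proof.
move=> ab acx cG.
apply: (@cousin_induction R a b
  (fun t => exists M, forall s, a <= s <= t -> G (x s) <= M)) => //.
  exists (G (x a)) => s; rewrite -eq_le => /eqP <-; exact: lexx.
move=> t tab.
have nG : nbhs (x t) [set y | G y < G (x t) + 1].
  have n1 : nbhs (G (x t)) [set u | u < G (x t) + 1].
    by apply: lt_nbhsl; rewrite ltrDl.
  exact: (cG (x t) _ n1).
have [r r0 Hr] := ac_near acx tab nG.
exists r => // s s' as_ s'b trs st ts' s'r [M HM].
exists (Num.max M (G (x t) + 1)) => u /andP[au us'].
have [us|su] := leP u s; first by rewrite le_max HM// au us.
have /= := Hr u; rewrite le_max => /(_ _ _ _)/ltW ->; rewrite ?orbT//; lra.
Qed.

(** The difference quotient over an interval that straddles t is a convex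
combination of the one-sided quotients at t. *)
Lemma derive_le0_gauge (R : realType) (h : R -> R) (t dh eps : R) :
  is_derive t 1 h dh -> dh <= 0 -> 0 < eps ->
  exists2 r : R, 0 < r & forall s s', t - r < s -> s <= t -> t <= s' ->
    s' < t + r -> h s' - h s <= eps * (s' - s).
Proof.
move=> [dh1 dhE] dh0 eps0; move: dh1; rewrite /derivable -/(derive _ _ _) => dh1.
have : (k^-1 *: ((h \o shift t) (k *: 1) - h t)) @[k --> 0^'] --> dh.
  by rewrite -dhE; exact: dh1.
move=> /cvgrPdist_lt /(_ _ eps0); rewrite near_withinE.
move=> /nbhs_ballP[r /= r0 Hr].
have key k : k != 0 -> `|k| < r -> `|dh - k^-1 * (h (k + t) - h t)| < eps.
  move=> k0 kr; have := Hr k; rewrite /ball/= sub0r normrN => /(_ kr k0).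
  by rewrite /GRing.scale/= mulr1.
exists r => // s s' trs st ts' s'r.
have right : h s' - h t <= eps * (s' - t).
  have [->|nst] := eqVneq s' t; first by rewrite !subrr mulr0.
  have k0 : 0 < s' - t by rewrite subr_gt0 lt_neqAle eq_sym nst.
  have := key (s' - t) (lt0r_neq0 k0); rewrite gtr0_norm// subrK => /(_ _)/ltr_normlP[|].
    lra.
  move=> H _; have : (s' - t)^-1 * (h s' - h t) <= eps by lra.
  by rewrite mulrC ler_pdivrMr.
have left : h t - h s <= eps * (t - s).
  have [->|nst] := eqVneq s t; first by rewrite !subrr mulr0.
  have k0 : 0 < t - s by rewrite subr_gt0 lt_neqAle nst.
  have := key (s - t); rewrite subr_eq0 => /(_ nst).
  rewrite ltr0_norm; last lra.
  rewrite opprB subrK => /(_ _)/ltr_normlP[|].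
    lra.
  rewrite -[(s - t)^-1 * _]mulrNN -invrN !opprB.
  move=> H _; have : (t - s)^-1 * (h t - h s) <= eps by lra.
  by rewrite mulrC ler_pdivrMr.
by have := lerD right left; rewrite -mulrDr !addrA !subrK.
Qed.

Lemma expR_diff_le (R : realType) (l a b s s' : R) :
  0 <= l -> s <= s' -> s' <= b ->
  expR (l * (s' - a)) - expR (l * (s - a)) <= l * expR (l * (b - a)) * (s' - s).
Proof.
move=> l0 ss' s'b.
have -> : l * (s - a) = l * (s' - a) - l * (s' - s) by ring.
rewrite expRD -{1}[expR (l * (s' - a))]mulr1 -mulrBr mulrAC mulrC.
have h1 := expR_ge1Dx (- (l * (s' - s))).
apply: ler_pM; rewrite ?expR_ge0//; last by rewrite ler_expR; nra.
  rewrite subr_ge0 -expR0 ler_expR; nra.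
lra.
Qed.

(** A Gronwall argument: the function
h(t) = exp(l (t - a)) V(x(t)) - C exp(l (b - a)) (t - a)
has nonpositive derivative outside E, because exp(l (t - a)) <= exp(l (b - a)).
Near E its increments are bounded by those of x, since V is locally Lipschitz
with a constant uniform along the path. *)
Lemma lyapunov_decay (R : realType) (n : nat) (V : 'rV[R]_n -> R)
    (x : R -> 'rV[R]_n) (xdot : R -> 'rV[R]_n) (E : set R) (a b l C : R) :
  Ck_on 1 setT V -> (forall y, 0 <= V y) ->
  a <= b -> 0 <= l -> 0 <= C -> absolutely_continuous a b x ->
  (@lebesgue_measure R).-negligible E ->
  (forall t, a <= t < b -> ~ E t ->
     is_derive t 1 x (xdot t) /\ 'd V (x t) (xdot t) <= - l * V (x t) + C) ->
  V (x b) <= expR (- (l * (b - a))) * V (x a) + C * (b - a).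
Proof.
move=> V1 V0 ab l0 C0 acx E0 ode.
pose A := expR (l * (b - a)).
pose h t := expR (l * (t - a)) * V (x t) - C * A * (t - a).
have A0 : 0 < A by exact: expR_gt0.
have cV : continuous V by move=> y; apply: differentiable_continuous; exact: C1_differentiable.
have [M1 HM1] := ac_bounded ab acx cV.
have [M2 HM2] := ac_bounded ab acx (grad_norm_continuous V1).
have M10 : 0 <= M1 by apply: le_trans (V0 _) (HM1 a _); rewrite lexx.
have M20 : 0 <= M2.
  by apply: le_trans (HM2 a _); rewrite ?lexx//; exact: sumr_ge0.
suff hab : h b <= h a.
  move: hab; rewrite /h subrr !mulr0 expR0 mul1r subr0 -/A => hab.
  have : V (x b) - C * (b - a) <= A^-1 * V (x a).
    rewrite [leRHS]mulrC ler_pdivlMr//; lra.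
  by rewrite expRN -/A; lra.
(* A (M2 + 1) bounds the variation of V(x) and M1 l A that of the exponential
   weight. *)
pose K := A * (M2 + 1) + M1 * (l * A).
have K1 : A * (M2 + 1) <= K by rewrite lerDl !mulr_ge0// ltW.
have K2 : M1 * (l * A) <= K by rewrite lerDr !mulr_ge0// ?ltW//; lra.
have K0 : 0 <= K by rewrite addr_ge0// !mulr_ge0// ?ltW//; lra.
(* The differential inequality is not assumed at the endpoint b, which joins
   the null set. *)
apply: (@gauge_nonincreasing R n x h a b K (E `|` [set b])) => //.
- apply: negligibleU => //; exists [set b]; split => //.
  exact: lebesgue_measure_set1.
- move=> t /andP[at_ tb] /not_orP[nEt /eqP ntb] eps eps0.
  have [|dx dV] := ode t _ nEt; first by rewrite at_ lt_neqAle ntb.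
  have dVx : is_derive t 1 (V \o x) ('d V (x t) (xdot t)).
    by apply: is_derive_diff_comp => //; exact: C1_differentiable.
  have de : is_derive t 1 (fun u : R => expR (l * (u - a))) (l * expR (l * (t - a))).
    have d1 : is_derive t 1 (l \*: (id - cst a) : R -> R) (l *: (1 - 0)).
      exact: is_deriveZ.
    have d2 := is_derive1_comp (is_derive_expR _) d1.
    by apply: (is_derive_eq d2); rewrite /GRing.scale/= subr0 mulr1 mulrC.
  have dh : is_derive t 1 h
     (expR (l * (t - a)) * 'd V (x t) (xdot t)
       + V (x t) * (l * expR (l * (t - a))) - C * A).
    have d3 : is_derive t 1 ((C * A) \*: (id - cst a) : R -> R) ((C * A) *: (1 - 0)).
      exact: is_deriveZ.
    have d4 := is_deriveB (is_deriveM de dVx) d3.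
    by apply: (is_derive_eq d4); rewrite /GRing.scale/= subr0 mulr1 -addrA.
  have [|r r0 Hr] := derive_le0_gauge dh _ eps0.
    have eA : expR (l * (t - a)) <= A by rewrite ler_expR; nra.
    have e0 := expR_gt0 (l * (t - a)).
    have : expR (l * (t - a)) * ('d V (x t) (xdot t) + l * V (x t)) <= A * C.
      apply: le_trans (ler_wpM2r C0 eA); apply: ler_wpM2l; [exact: ltW|lra].
    lra.
  by exists r => // s s' _ _; exact: Hr.
- move=> t tab _.
  have [|rho rho0 lip] := @C1_lipschitz _ _ V (x t) (M2 + 1) V1.
    by rewrite (le_lt_trans (HM2 t tab))// ltrDl.
  have [r r0 Hr] := ac_near acx tab (nbhsx_ballx _ _ rho0).
  exists r => // s s' as_ s'b trs st ts' s'r.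
  have ss0 : 0 <= s' - s by lra.
  have dV : V (x s') - V (x s) <= (M2 + 1) * enorm (x s' - x s).
    by apply: lip; apply: Hr; lra.
  have ee : expR (l * (s' - a)) - expR (l * (s - a)) <= l * A * (s' - s).
    by apply: expR_diff_le => //; lra.
  have eA : expR (l * (s' - a)) <= A by rewrite ler_expR; nra.
  have p1 : expR (l * (s' - a)) * (V (x s') - V (x s)) <=
      A * (M2 + 1) * enorm (x s' - x s).
    rewrite -mulrA; apply: le_trans (ler_wpM2r _ eA); last first.
      by rewrite mulr_ge0 ?enorm_ge0//; lra.
    by rewrite ler_wpM2l ?expR_ge0.
  have p2 : V (x s) * (expR (l * (s' - a)) - expR (l * (s - a))) <=
      M1 * (l * A) * (s' - s).
    have sab : a <= s <= b by lra.
    apply: le_trans (ler_wpM2l (V0 _) ee) _; rewrite -!mulrA.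
    apply: ler_wpM2r; last exact: HM1.
    exact: mulr_ge0 l0 (mulr_ge0 (ltW A0) ss0).
  have p3 : 0 <= C * A * (s' - s) by rewrite !mulr_ge0// ltW.
  have p4 := ler_wpM2r (enorm_ge0 (x s' - x s)) K1.
  have p5 := ler_wpM2r ss0 K2.
  rewrite /h; lra.
Qed.

(** * Dissipation under Sontag's feedback *)

Lemma class_K_gt0 (R : realType) (a : R -> R) (r : R) :
  class_K a -> 0 < r -> 0 < a r.
Proof.
move=> [_ inc _ a0] r0; rewrite -[ltLHS]a0.
by apply: inc => //; rewrite in_itv/= andbT// ltW.
Qed.

Lemma class_K_le (R : realType) (a : R -> R) (r s : R) :
  class_K a -> 0 <= r -> r <= s -> a r <= a s.
Proof.
move=> [_ inc _ _] r0; rewrite le_eqVlt => /predU1P[->//|rs].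
by apply/ltW/inc => //; rewrite in_itv/= andbT//; lra.
Qed.

Lemma enorm0 (R : realType) (n : nat) : enorm (0 : 'rV[R]_n) = 0.
Proof.
by rewrite /enorm big1 ?sqrtr0// => i _; rewrite mxE expr0n.
Qed.

Lemma enorm_gt0 (R : realType) (n : nat) (v : 'rV[R]_n) : v != 0 -> 0 < enorm v.
Proof.
move=> v0; rewrite lt_neqAle enorm_ge0 andbT eq_sym.
by apply: contra v0 => /eqP/enorm_eq0 ->.
Qed.

Lemma le_max_value (R : realType) (T : Type) (h : T -> R) (d : T) :
  has_max_value h -> h d <= max_value h.
Proof.
move=> [d0 Hd0]; apply: ub_le_sup; last by exists d.
by exists (h d0) => _ [d' _ <-].
Qed.

Lemma max_value_le (R : realType) (T : Type) (h : T -> R) (M : R) :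
  has_max_value h -> (forall d, h d <= M) -> max_value h <= M.
Proof.
move=> [d0 _] hM; apply: ge_sup; first by exists (h d0), d0.
by move=> _ [d _ <-].
Qed.

(** The formula is the one for which a + b u equals - sqrt(a^2 + |b|^4). *)
Lemma sontag_pairing (R : realType) (m : nat) (a : R) (b : 'rV[R]_m) :
  b != 0 ->
  a + \sum_(i < m) b ord0 i * sontag a b ord0 i = - Num.sqrt (a ^+ 2 + enorm b ^+ 4).
Proof.
move=> b0; rewrite /sontag (negbTE b0).
under eq_bigr do rewrite mxE mulrCA -expr2.
rewrite -mulr_sumr.
have -> : \sum_(i < m) b ord0 i ^+ 2 = enorm b ^+ 2.
  by rewrite sqr_sqrtr//; apply: sumr_ge0 => i _; exact: sqr_ge0.
by rewrite mulNr divfK ?sqrf_eq0 ?gt_eqF ?enorm_gt0// opprD addrA subrr add0r.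
Qed.

(** If W != 0, then w plus the pairing of W with the control is nonpositive,
and w dominates M + lambda V.  If W = 0, the infimum in the control Lyapunov
condition is over a constant, so M <= - 3 lambda V. *)
Lemma sontag_dissipation (R : realType) (n k m : nat)
    (f : 'rV[R]_n -> 'rV[R]_k -> 'rV[R]_n) (g : 'I_m -> 'rV[R]_n -> 'rV[R]_n)
    (V : 'rV[R]_n -> R) (chi : R -> R) (lambda w : R) (x : 'rV[R]_n)
    (W : 'rV[R]_m) (d : 'rV[R]_k) :
  let M := max_value (fun d : 'rV[R]_k => 'd V x (f x d) - chi (enorm d)) in
  W = \row_(i < m) lie_derivative (g i) V x ->
  0 <= lambda -> 0 <= V x ->
  has_max_value (fun d : 'rV[R]_k => 'd V x (f x d) - chi (enorm d)) ->
  (forall d : 'rV[R]_k,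
     (ereal_inf [set ('d V x (f x d) + 3 * lambda * V x
        + \sum_(i < m) lie_derivative (g i) V x * u ord0 i)%:E
        | u in [set: 'rV[R]_m]] <= (chi (enorm d))%:E)%E) ->
  M + lambda * V x <= w ->
  'd V x (f x d + \sum_(i < m) sontag w W ord0 i *: g i x)
    <= - lambda * V x + chi (enorm d).
Proof.
move=> M WE l0 V0 hmax clf Mw.
have dM : 'd V x (f x d) - chi (enorm d) <= M.
  exact: (@le_max_value _ _ (fun d : 'rV[R]_k => 'd V x (f x d) - chi (enorm d))).
have -> : 'd V x (f x d + \sum_(i < m) sontag w W ord0 i *: g i x)
    = 'd V x (f x d) + \sum_(i < m) W ord0 i * sontag w W ord0 i.
  rewrite linearD linear_sum/=; congr (_ + _); apply: eq_bigr => i _.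
  by rewrite linearZ/= WE mxE mulrC.
have lV := mulr_ge0 l0 V0.
have [W0|Wn0] := eqVneq W 0; last first.
  have := sontag_pairing w Wn0.
  have := sqrtr_ge0 (w ^+ 2 + enorm W ^+ 4).
  lra.
rewrite big1; last by move=> i _; rewrite W0 mxE mul0r.
suff MV : M <= - (3 * lambda * V x) by lra.
apply: max_value_le => // e.
have := clf e.
have -> : [set ('d V x (f x e) + 3 * lambda * V x
        + \sum_(i < m) lie_derivative (g i) V x * u ord0 i)%:E
        | u in [set: 'rV[R]_m]] = [set ('d V x (f x e) + 3 * lambda * V x)%:E].
  have s0 (u : 'rV[R]_m) : \sum_(i < m) lie_derivative (g i) V x * u ord0 i = 0.
    apply: big1 => i _; have /rowP/(_ i) := WE; rewrite W0 !mxE => <-.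
    by rewrite mul0r.
  apply/seteqP; split => [_ [u _ <-]|_ ->]; first by rewrite s0 addr0.
  by exists 0 => //; rewrite s0 addr0.
rewrite ereal_inf1 lee_fin; lra.
Qed.

Lemma diff_at_min (R : realType) (n : nat) (V : 'rV[R]_n -> R)
    (x v : 'rV[R]_n) :
  (forall y, differentiable V y) -> (forall y, V x <= V y) -> 'd V x v = 0.
Proof.
move=> dV minV.
have dphi : is_derive (0 : R) 1 (fun u : R => V (x + u *: v)) ('d V x v).
  have E : x + (0 : R) *: v = x by rewrite scale0r addr0.
  rewrite -[X in 'd V X]E.
  apply: (is_derive_diff_comp (x := fun u : R => x + u *: v)).
    exact: dV.
  exact: is_derive_segment.
have d0 : is_derive (0 : R) 1 (fun u : R => V (x + u *: v)) 0.
  have dline (t : R) : derivable (fun u : R => V (x + u *: v)) t 1.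
    have dl := is_derive_segment x v t.
    exact: (@ex_derive _ _ _ _ _ _ _ (is_derive_diff_comp (dV _) dl)).
  have le11 : (-1 : R) <= 1 by lra.
  have in01 : (0 : R) \in `](-1 : R), (1 : R)[ by rewrite in_itv/= ltrN10 ltr01.
  apply: (derive1_at_min le11 _ in01) => [t _|t _]; first exact: dline.
  by rewrite scale0r addr0; exact: minV.
by rewrite -(@derive_val _ _ _ _ _ _ _ dphi) (@derive_val _ _ _ _ _ _ _ d0).
Qed.

(** * Expectations of products of independent random variables *)

(** The integral of a nonnegative function, measurable or not, is a supremum
over the simple functions below it.  Replacing g by +oo on the exceptional null
set turns the hypothesis into a pointwise one without changing the integral of
g. *)
Lemma integral_le_ae_majorant (R : realType) (dO : measure_display)
    (Omega : measurableType dO) (mu : {measure set Omega -> \bar R})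
    (f g : Omega -> \bar R) :
  (forall w, 0 <= f w)%E -> (forall w, 0 <= g w)%E -> measurable_fun setT g ->
  {ae mu, forall w, (f w <= g w)%E} ->
  (\int[mu]_w f w <= \int[mu]_w g w)%E.
Proof.
move=> f0 g0 mg [A [mA A0 badA]].
pose oA : Omega -> \bar R := (cst +oo%E) \_ A.
have oA0 w : (0 <= oA w)%E by rewrite /oA patchE; case: ifP => _ /=; rewrite ?leey.
have moA : measurable_fun setT oA by apply/(measurable_restrictT _ mA).1.
pose g' w := (g w + oA w)%E.
have g'0 w : (0 <= g' w)%E by rewrite adde_ge0.
have mg' : measurable_fun setT g' by exact: emeasurable_funD.
have -> : (\int[mu]_w g w = \int[mu]_w g' w)%E.
  apply: ge0_ae_eq_integral => //; exists A; split => // w /= ngg'.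
  apply: contrapT => nAw; apply: ngg' => _; by rewrite /g' /oA patchE memNset// adde0.
rewrite !ge0_integralTE//; apply: le_ereal_sup => _ [h hf <-].
exists h => // w; apply: le_trans (hf w) _; rewrite /g' /oA patchE.
case: ifPn => [_|/negP nA].
  by rewrite addey ?leey// gt_eqF// (lt_le_trans _ (g0 w))// ltNy0.
rewrite adde0; apply: contrapT => nfg; apply: nA; rewrite inE; exact: badA.
Qed.

Import HBNNSimple.

(** The hypothesis is the case where X is replaced by an indicator of an
event about X; simple functions of X follow by linearity, and X itself by
monotone convergence. *)
Lemma integral_factor_out (R : realType) (dO : measure_display)
    (Omega : measurableType dO) (P : probability Omega R)
    (Z X : Omega -> R) (c : R) :
  measurable_fun setT Z -> measurable_fun setT X ->
  (forall w, 0 <= Z w) -> (forall w, 0 <= X w) -> 0 <= c ->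
  (forall A : set R, measurable A ->
     (\int[P]_w (Z w * \1_(X @^-1` A) w)%:E = c%:E * P (X @^-1` A))%E) ->
  (\int[P]_w (Z w * X w)%:E = c%:E * \int[P]_w (X w)%:E)%E.
Proof.
move=> mZ mX Z0 X0 c0 HA.
(* Truncation makes f nonnegative on the whole line and keeps f (X w) = X w. *)
pose f (r : R) : \bar R := (Num.max r 0)%:E.
have mf : measurable_fun setT f.
  by apply/measurable_EFinP; exact: measurable_maxr.
have f0 r : (0 <= f r)%E by rewrite lee_fin le_max lexx orbT.
pose f_ := nnsfun_approx measurableT mf.
have fcv w : EFin \o f_^~ (X w) @ \oo --> (X w)%:E.
  have -> : (X w)%:E = f (X w) by rewrite /f max_l.
  exact: cvg_nnsfun_approx.
have mfX n : measurable_fun setT (fun w => f_ n (X w)).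
  by apply: measurableT_comp mX; exact: measurable_funP.
have fX0 n w : 0 <= f_ n (X w) by [].
have fnd w : {homo (fun n => f_ n (X w)) : a b / (a <= b)%N >-> a <= b}.
  by move=> a b ab; have /lefP := nd_nnsfun_approx measurableT mf ab; apply.
have step n : (\int[P]_w (Z w * f_ n (X w))%:E =
               c%:E * \int[P]_w (f_ n (X w))%:E)%E.
  have split w : f_ n (X w) =
      \sum_(y \in range (f_ n)) y * \1_(X @^-1` (f_ n @^-1` [set y])) w.
    by rewrite (fimfunE (f_ n) (X w)).
  have fin : finite_set (range (f_ n)) by exact: fimfunP.
  have mpre y : measurable (X @^-1` (f_ n @^-1` [set y])).
    by rewrite -[X in measurable X]setTI; apply: mX => //; exact: measurable_sfunP.
  have y0 y : range (f_ n) y -> 0 <= y by move=> [r _ <-].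
  pose B y := X @^-1` (f_ n @^-1` [set y]).
  have mB y : measurable_fun setT (\1_(B y) : Omega -> R).
    by apply: measurable_indic; exact: mpre.
  have EZ : (\int[P]_w (Z w * f_ n (X w))%:E = \sum_(y <- fset_set (range (f_ n)))
      \int[P]_w ((Num.max y 0)%:E * (Z w * \1_(B y) w)%:E))%E.
    rewrite -ge0_integral_sum//; last 2 first.
    - move=> y; apply: emeasurable_funM; first exact: measurable_cst.
      by apply/measurable_EFinP; exact: measurable_funM.
    - by move=> y w _; rewrite mule_ge0// lee_fin ?le_max ?lexx ?orbT// mulr_ge0.
    apply: eq_integral => w _; rewrite split fsbig_finite//= mulr_sumr -sumEFin.
    rewrite !big_seq; apply: eq_bigr => y; rewrite in_fset_set// inE => /y0 yge0.
    by rewrite max_l// -EFinM mulrCA.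
  have EX : (\int[P]_w (f_ n (X w))%:E = \sum_(y <- fset_set (range (f_ n)))
      \int[P]_w ((Num.max y 0)%:E * (\1_(B y) w)%:E))%E.
    rewrite -ge0_integral_sum//; last 2 first.
    - move=> y; apply: emeasurable_funM; first exact: measurable_cst.
      by apply/measurable_EFinP.
    - by move=> y w _; rewrite mule_ge0// lee_fin ?le_max ?lexx ?orbT.
    apply: eq_integral => w _; rewrite split fsbig_finite//= -sumEFin.
    rewrite !big_seq; apply: eq_bigr => y; rewrite in_fset_set// inE => /y0 yge0.
    by rewrite max_l// -EFinM.
  rewrite EZ EX ge0_sume_distrr; last first.
    by move=> y _; apply: integral_ge0 => w _; rewrite mule_ge0// lee_fin ?le_max ?lexx ?orbT.
  apply: eq_bigr => y _.
  have my0 : (0 <= (Num.max y 0)%:E :> \bar R)%E by rewrite lee_fin le_max lexx orbT.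
  rewrite !ge0_integralZl//.
  - rewrite HA; last exact: measurable_sfunP.
    by rewrite integral_indic ?setIT 1?muleCA//; exact: mpre.
  - by apply/measurable_EFinP.
  - by apply/measurable_EFinP; exact: measurable_funM.
  - by move=> w _; rewrite lee_fin mulr_ge0.
transitivity (limn (fun n => \int[P]_w (Z w * f_ n (X w))%:E)%E).
  rewrite -monotone_convergence//.
  - apply: eq_integral => w _; apply/esym/cvg_lim => //.
    under eq_fun do rewrite EFinM.
    by rewrite EFinM; apply: cvgeZl => //; exact: fcv.
  - by move=> n; apply/measurable_EFinP; exact: measurable_funM.
  - by move=> n w _; rewrite lee_fin mulr_ge0.
  - by move=> w _ a b ab; rewrite lee_fin ler_wpM2l// fnd.
under eq_fun do rewrite step.
apply/cvg_lim => //; apply: cvgeZl => //.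
have -> : (\int[P]_w (X w)%:E = \int[P]_w limn (fun n => (f_ n (X w))%:E))%E.
  by apply: eq_integral => w _; apply/esym/cvg_lim => //; exact: fcv.
apply: cvg_monotone_convergence => //.
- by move=> n; apply/measurable_EFinP.
- by move=> n w _; rewrite lee_fin.
- by move=> w _ a b ab; rewrite lee_fin fnd.
Qed.

(** The factors are extracted one at a time: for A a set of reals, the event
that B holds and X_i lies in A inherits the independence hypothesis with
respect to the remaining variables, which gives the premise of
[integral_factor_out].  Carrying an event B through the induction is what makes
it go through. *)
Lemma expectation_indic_prod (R : realType) (dO : measure_display)
    (Omega : measurableType dO) (P : probability Omega R) (I : eqType)
    (X : I -> Omega -> R) (e : I -> R) (s : seq I) :
  uniq s ->
  (forall i, measurable_fun setT (X i)) -> (forall i w, 0 <= X i w) ->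
  (forall i, \int[P]_w (X i w)%:E = (e i)%:E)%E ->
  forall B : set Omega, measurable B ->
  (forall A : I -> set R, (forall i, measurable (A i)) ->
    P (B `&` \bigcap_(i in [set` s]) X i @^-1` A i)
      = (P B * \prod_(i <- s) P (X i @^-1` A i))%E) ->
  (\int[P]_w (\1_B w * \prod_(i <- s) X i w)%:E = P B * (\prod_(i <- s) e i)%:E)%E.
Proof.
move=> us mX X0 Xe.
have e0 i : 0 <= e i.
  by rewrite -lee_fin -Xe; apply: integral_ge0 => w _; rewrite lee_fin.
have mXpre i (A : set R) : measurable A -> measurable (X i @^-1` A).
  by move=> mA; rewrite -[X in measurable X]setTI; exact: mX.
elim: s us => [_|i s IH /= /andP[nis us]] B mB indep.
  rewrite big_nil mule1 -[in RHS](setIT B) -integral_indic//.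
  by apply: eq_integral => w _; rewrite big_nil mulr1.
have PBfin : P B = (fine (P B))%:E by rewrite fineK// fin_num_measure.
have mZ : measurable_fun setT (fun w => \1_B w * \prod_(j <- s) X j w).
  apply: measurable_funM; first exact: measurable_indic.
  exact: measurable_prod.
have Z0 w : 0 <= \1_B w * \prod_(j <- s) X j w.
  by rewrite mulr_ge0// prodr_ge0.
pose c := fine (P B) * \prod_(j <- s) e j.
have c0 : 0 <= c by rewrite mulr_ge0 ?fine_ge0// prodr_ge0.
transitivity (\int[P]_w (\1_B w * \prod_(j <- s) X j w * X i w)%:E)%E.
  by apply: eq_integral => w _; rewrite big_cons mulrA mulrAC.
rewrite (integral_factor_out (c := c))//; last first.
  move=> A mA; pose B' := B `&` X i @^-1` A.
  have mB' : measurable B' by apply: measurableI => //; exact: mXpre.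
  have indep' (A' : I -> set R) : (forall j, measurable (A' j)) ->
      P (B' `&` \bigcap_(j in [set` s]) X j @^-1` A' j) =
      (P B * P (X i @^-1` A) * \prod_(j <- s) P (X j @^-1` A' j))%E.
    move=> mA'; have := indep (fun j => if j == i then A else A' j).
    rewrite big_cons eqxx => H.
    have -> : B' `&` \bigcap_(j in [set` s]) X j @^-1` A' j =
      B `&` \bigcap_(j in [set` i :: s]) X j @^-1` (if j == i then A else A' j).
      apply/seteqP; split => w.
        move=> [[Bw Aw] sw]; split => // j /=; rewrite inE.
        by have [->//|/= _ js] := eqVneq j i; exact: sw.
      move=> [Bw Hw]; split; first split => //.
        by have := Hw i; rewrite eqxx; apply; rewrite /= inE eqxx.
      move=> j /= js; have := Hw j; rewrite ifN; first by apply; rewrite /= inE js orbT.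
      by apply: contra nis => /eqP <-.
    rewrite H => [|j]; last by case: ifP.
    rewrite muleA; congr (_ * _)%E; rewrite !big_seq; apply: eq_bigr => j js.
    by rewrite ifN//; apply: contra nis => /eqP <-.
  have PB' : P B' = (P B * P (X i @^-1` A))%E.
    have := indep' (fun=> setT) (fun=> measurableT).
    rewrite bigcapT// setIT => ->; rewrite big1 ?mule1// => j _.
    by rewrite preimage_setT probability_setT.
  transitivity (\int[P]_w (\1_B' w * \prod_(j <- s) X j w)%:E)%E.
    apply: eq_integral => w _; congr _%:E; rewrite /B' indicI /=; ring.
  rewrite IH//; last by move=> A' mA'; rewrite indep'// PB'.
  by rewrite PB' PBfin /c EFinM muleAC.
by rewrite Xe big_cons PBfin -!EFinM /c -mulrA [e i * _]mulrC.
Qed.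

(** Mutual independence ranges over finite sets of indices; products over a
finite type are more convenient, and the whole type is the image of such a
set under h. *)
Lemma mutually_independent_inj (R : realType) (dO : measure_display)
    (Omega : measurableType dO) (P : probability Omega R)
    (K : choiceType) (F : K -> set (set Omega)) (I : finType) (h : I -> K)
    (A : I -> set Omega) :
  mutually_independent P F -> injective h -> (forall i, F (h i) (A i)) ->
  P (\bigcap_i A i) = (\prod_i P (A i))%E.
Proof.
move=> indep hinj FA.
pose A' k := if [pick i | h i == k] is Some i then A i else setT.
have A'h i : A' (h i) = A i.
  rewrite /A'; case: pickP => [j /eqP/hinj ->//|/(_ i)]; by rewrite eqxx.
pose s := [seq h i | i <- enum I].
have := indep [fset k in s]%fset A'.
have -> : [set` [fset k in s]%fset] = range h.
  apply/seteqP; split => k /=; rewrite !inE.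
    by move=> /mapP[i _ ->]; exists i.
  by move=> [i _ <-]; apply: map_f; rewrite mem_enum.
rewrite bigcap_image (eq_bigcapr (G := A)); last by move=> i _; rewrite A'h.
move=> -> //; last first.
  by move=> k; rewrite !inE => /mapP[i _ ->]; rewrite A'h.
rewrite (perm_big s); last first.
  apply: uniq_perm; rewrite ?fset_uniq//.
    by rewrite map_inj_uniq// enum_uniq.
  by move=> k; rewrite !inE.
by rewrite big_map big_enum; apply: eq_bigr => i _; rewrite A'h.
Qed.

(** * Exponentials of uniform holding times and their products *)

Lemma is_derive_expR_lin (R : realType) (l t : R) :
  is_derive t 1 (fun u : R => expR (- (l * u))) (- l * expR (- (l * t))).
Proof.
have d1 : is_derive t 1 ((- l) \*: id : R -> R) ((- l) *: 1).
  exact: is_deriveZ.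
have d2 := is_derive1_comp (is_derive_expR _) d1.
have -> : (fun u : R => expR (- (l * u))) = expR \o ((- l) \*: id : R -> R).
  by apply/funext => u /=; rewrite /GRing.scale/= mulNr.
by apply: (is_derive_eq d2); rewrite /GRing.scale/= mulr1 mulrC -(mulNr l t).
Qed.

Lemma integral_expR_uniform (R : realType) (T l : R) (T0 : 0 < T) :
  (\int[uniform_prob T0]_t (expR (- (l * t)))%:E = (mean_decay l T)%:E)%E.
Proof.
rewrite integral_uniform; last 2 first.
- by apply/measurable_EFinP; apply: measurableT_comp => //; apply: measurableT_comp => //;
    exact: measurable_funM.
- by move=> t; rewrite lee_fin expR_ge0.
rewrite subr0 /mean_decay; case: eqP => [->|/eqP l0].
  under eq_integral do rewrite mul0r oppr0 expR0.
  rewrite integral_cst//= lebesgue_measure_itv/= lte_fin T0 sube0 mul1e -EFinM.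
  by rewrite mulVf ?gt_eqF.
pose F (t : R) := - l^-1 * expR (- (l * t)).
have dF (t : R) : is_derive t 1 F (expR (- (l * t))).
  have d1 := is_deriveZ (- l^-1) (is_derive_expR_lin l t).
  by apply: (is_derive_eq d1); rewrite /GRing.scale/= mulrA mulrNN mulVf// mul1r.
have cexp (t : R) : {for t, continuous (fun u : R => expR (- (l * u)))}.
  apply: differentiable_continuous; apply/derivable1_diffP.
  exact: (@ex_derive _ _ _ _ _ _ _ (is_derive_expR_lin l t)).
have cF (t : R) : {for t, continuous F}.
  apply: differentiable_continuous; apply/derivable1_diffP.
  exact: (@ex_derive _ _ _ _ _ _ _ (dF t)).
rewrite (@continuous_FTC2 _ _ F)//.
- rewrite /F mulr0 oppr0 expR0 -EFinB -EFinM; congr _%:E.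
  by field; rewrite l0 gt_eqF.
- by apply: continuous_subspaceT.
- split.
  + by move=> t _; exact: (@ex_derive _ _ _ _ _ _ _ (dF t)).
  + by apply: cvg_at_right_filter; exact: cF.
  + by apply: cvg_at_left_filter; exact: cF.
- by move=> t _; rewrite derive1E (@derive_val _ _ _ _ _ _ _ (dF t)).
Qed.

Lemma integral_expR_uniform_rv (R : realType) (dO : measure_display)
    (Omega : measurableType dO) (P : probability Omega R) (S : Omega -> R)
    (T l : R) (T0 : 0 < T) :
  measurable_fun setT S ->
  (forall A, measurable A -> P (S @^-1` A) = uniform_prob T0 A) ->
  (\int[P]_w (expR (- (l * S w)))%:E = (mean_decay l T)%:E)%E.
Proof.
move=> mS law; rewrite -(integral_expR_uniform l T0).
have [Sf SfE] : exists Sf : {mfun Omega >-> measurableTypeR R}, Sf = S :> (Omega -> R).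
  have mS' : @measurable_fun _ _ Omega (measurableTypeR R) setT S := mS.
  by exists (mfun_Sub (aT := Omega) (rT := measurableTypeR R) (mem_set mS')).
rewrite -(@eq_measure_integral _ _ _ _ (uniform_prob T0) (distribution P Sf)).
  rewrite ge0_integral_distribution//.
  - by rewrite SfE.
  - by apply/measurable_EFinP; apply: measurableT_comp => //;
      apply: measurableT_comp => //; exact: measurable_funM.
by move=> A mA _; rewrite -SfE in law; exact: law.
Qed.

Definition jump_factor (R : realType) (Omega : Type) (N : nat)
    (sigma : R -> Omega -> 'I_N) (tau : nat -> Omega -> R) (mu : R)
    (lambda : 'I_N -> R) (i : nat) (w : Omega) : R :=
  mu * expR (- (lambda (switched_value sigma tau i w) * holding_time tau i w)).

(** Written as a sum over the values of the signal, the factor is a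
combination of indicators times functions of a single holding time. *)
Lemma jump_factorE (R : realType) (Omega : Type) (N : nat)
    (sigma : R -> Omega -> 'I_N) (tau : nat -> Omega -> R) (mu : R)
    (lambda : 'I_N -> R) (i : nat) (w : Omega) :
  jump_factor sigma tau mu lambda i w =
  \sum_(j < N) \1_[set w | switched_value sigma tau i w = j] w *
    (mu * expR (- (lambda j * holding_time tau i w))).
Proof.
rewrite (bigD1 (switched_value sigma tau i w))//= big1 ?addr0.
  by rewrite indicE mem_set// mul1r.
move=> j nj; rewrite indicE memNset ?mul0r// => /= Ej.
by rewrite Ej eqxx in nj.
Qed.

Lemma prod_indic (R : realType) (T : Type) (I : finType) (B : I -> set T) (w : T) :
  \prod_i (\1_(B i) w : R) = \1_(\bigcap_i B i) w.
Proof.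
have [Bw|nBw] := pselect ((\bigcap_i B i) w).
  rewrite [RHS]indicE mem_set// big1// => i _; rewrite indicE mem_set//; exact: Bw.
rewrite [RHS]indicE memNset//.
have [i nBi] : exists i, ~ B i w.
  by apply: contrapT => /forallNP H; apply: nBw => i _; apply: contrapT; exact: H.
by rewrite (bigD1 i)//= indicE memNset// mul0r.
Qed.

Section UH.
Context (R : realType) (dO : measure_display) (Omega : measurableType dO)
  (P : probability Omega R) (N : nat) (sigma : R -> Omega -> 'I_N)
  (tau : nat -> Omega -> R) (T : R) (q : 'I_N -> R)
  (UH : class_UH P sigma tau T q) (sw : switching_instants sigma tau).

Lemma measurable_holding_time i : measurable_fun setT (holding_time tau i).
Proof. by case: sw => mtau _ _ _; exact: measurable_funB. Qed.

Lemma measurable_jump_factor mu lambda i :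
  measurable_fun setT (jump_factor sigma tau mu lambda i).
Proof.
have -> : jump_factor sigma tau mu lambda i = (fun w =>
  \sum_(j < N) \1_[set w | switched_value sigma tau i w = j] w *
    (mu * expR (- (lambda j * holding_time tau i w)))).
  by apply/funext => w; exact: jump_factorE.
apply: measurable_sum => j; apply: measurable_funM.
  by apply: measurable_indic; exact: UH2_measurable UH i j.
apply: measurable_funM => //; apply: measurableT_comp => //.
apply: measurableT_comp => //; apply: measurable_funM => //.
exact: measurable_holding_time.
Qed.

(** The indices start at a > 0 because only the values sigma(tau_i) with
i > 0 are independent of the holding times. *)
Lemma expectation_value_path (a m : nat) (lambda : 'I_N -> R) (j : 'I_m -> 'I_N) :
  (0 < a)%N ->
  (\int[P]_w (\prod_(i < m) (\1_[set w | switched_value sigma tau (a + i) w = j i] w *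
      expR (- (lambda (j i) * holding_time tau (a + i) w))))%:E
   = (\prod_(i < m) (q (j i) * mean_decay (lambda (j i)) T))%:E)%E.
Proof.
move=> a0.
pose B := \bigcap_(i : 'I_m) [set w | switched_value sigma tau (a + i) w = j i].
have addI : injective (fun i : 'I_m => (a + i)%N).
  by move=> i1 i2 /addnI/val_inj.
have mJ (i : 'I_m) : measurable [set w | switched_value sigma tau (a + i) w = j i].
  exact: UH2_measurable UH _ _.
have PB : P B = (\prod_(i < m) (q (j i))%:E)%E.
  rewrite /B (mutually_independent_inj (UH2_independent UH) addI).
    by apply: eq_bigr => i _; rewrite (UH2_law UH).
  by move=> i; exists [set j i] => //; rewrite setTI.
transitivity (\int[P]_w (\1_B w *
    \prod_(i <- index_enum 'I_m) expR (- (lambda (j i) * holding_time tau (a + i) w)))%:E)%E.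
  by apply: eq_integral => w _; rewrite big_split/= prod_indic.
rewrite (@expectation_indic_prod _ _ _ _ _ _ (fun i => mean_decay (lambda (j i)) T)).
- by rewrite PB prodEFin -EFinM -big_split.
- exact: index_enum_uniq.
- move=> i; apply: measurableT_comp => //; apply: measurableT_comp => //.
  apply: measurable_funM => //; exact: measurable_holding_time.
- by move=> i w; exact: expR_ge0.
- move=> i; apply: (@integral_expR_uniform_rv _ _ _ _ _ _ _ (UH_T_gt0 UH)).
    exact: measurable_holding_time.
  exact: UH1_uniform.
- by apply: fin_bigcap_measurable.
- move=> A mA.
  pose h i t := expR (- (lambda (j i) * t)).
  have mhA i : measurable (h i @^-1` A i).
    rewrite -[X in measurable X]setTI.
    have : measurable_fun setT (h i); last by move=> /(_ measurableT); apply.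
    by apply: measurableT_comp => //; apply: measurableT_comp => //;
      exact: measurable_funM.
  pose D (i : 'I_m) := holding_time tau (a + i) @^-1` (h i @^-1` A i).
  have SD (i : 'I_m) : sigma_of_holding tau (a + i) (D i).
    by exists (h i @^-1` A i) => //; rewrite setTI.
  have PD : P (\bigcap_i D i) = (\prod_i P (D i))%E.
    exact: (mutually_independent_inj (UH1_independent UH) addI).
  have -> : \bigcap_(i in [set` index_enum 'I_m])
      (fun w => expR (- (lambda (j i) * holding_time tau (a + i) w))) @^-1` A i
      = \bigcap_i D i.
    rewrite (_ : [set` index_enum 'I_m] = setT)//.
    by apply/seteqP; split => // i _ /=; rewrite mem_index_enum.
  rewrite setIC (UH3 UH).
  + by rewrite PD muleC.
  + apply: (@fin_bigcap_measurable _ (g_sigma_algebraType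
      (\bigcup_i sigma_of_holding tau i))) => // i _.
    by apply: sub_sigma_algebra; exists (a + i)%N => //; exact: SD.
  + apply: (@fin_bigcap_measurable _ (g_sigma_algebraType
      (\bigcup_(i in [set i | (0 < i)%N]) sigma_of_value sigma tau i))) => // i _.
    apply: sub_sigma_algebra; exists (a + i)%N; first by rewrite /= addn_gt0 a0.
    by exists [set j i] => //; rewrite setTI.
Qed.

End UH.

Lemma mean_decay_ge0 (R : realType) (l T : R) : 0 < T -> 0 <= mean_decay l T.
Proof.
move=> T0; rewrite -lee_fin -(integral_expR_uniform l T0).
by apply: integral_ge0 => t _; rewrite lee_fin expR_ge0.
Qed.

(** * Comparison functions *)

Lemma class_K_scale (R : realType) (c : R) (a : R -> R) :
  0 < c -> class_K a -> class_K (fun r => c * a r).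
Proof.
move=> c0 [a0 inc ca a00]; split.
- by move=> r r0; rewrite mulr_ge0 ?a0// ltW.
- by move=> r s r0 s0 rs; rewrite ltr_pM2l// inc.
- by move=> r; apply: cvgM; [exact: cvg_cst|exact: ca].
- by rewrite a00 mulr0.
Qed.

Lemma class_Koo_scale (R : realType) (c : R) (a : R -> R) :
  0 < c -> class_Koo a -> class_Koo (fun r => c * a r).
Proof.
move=> c0 [aK aoo]; split; first exact: class_K_scale.
move=> M; have [r r0 Mr] := aoo (M / c); exists r => //.
by rewrite mulrC -ltr_pdivrMr.
Qed.

(** The geometric sequence rho^(s - 1) is extended to real s by the
exponential. *)
Lemma class_KL_geometric (R : realType) (c rho : R) (a : R -> R) :
  0 < c -> 0 < rho < 1 -> class_K a ->
  class_KL (fun r s => c * expR ((s - 1) * ln rho) * a r).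
Proof.
move=> c0 /ln_lt0 lr aK; split => [s s0|r r0].
  by apply: class_K_scale => //; rewrite mulr_gt0// expR_gt0.
have ar0 : 0 <= a r by case: aK => + _ _ _; exact.
split => [s t _ _ st|].
  by apply: ler_wpM2r => //; apply: ler_wpM2l; [exact: ltW|rewrite ler_expR; nra].
have E0 : expR ((s - 1) * ln rho) @[s --> +oo] --> (0 : R).
  have -> : (fun s : R => expR ((s - 1) * ln rho)) =
      (fun u => expR (- u)) \o (fun s => (s - 1) * - ln rho).
    by apply/funext => s /=; rewrite mulrN opprK.
  apply: cvg_comp (@cvgr_expR R).
  apply/cvgryPge => M; near=> s.
  rewrite -ler_pdivrMr ?oppr_gt0// lerBrDr.
  by near: s; apply: nbhs_pinfty_ge; exact: num_real.
rewrite -[X in _ --> X](mul0r (a r)) -(mulr0 c).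
by apply: cvgM; [apply: cvgM => //; exact: cvg_cst | exact: cvg_cst].
Unshelve. all: by end_near. Qed.

Lemma class_K_ge0 (R : realType) (a : R -> R) (r : R) :
  class_K a -> 0 <= r -> 0 <= a r.
Proof. by case=> + _ _ _; exact. Qed.

(** * The random bound and its expectation *)

Section UH.
Context (R : realType) (dO : measure_display) (Omega : measurableType dO)
  (P : probability Omega R) (N : nat) (sigma : R -> Omega -> 'I_N)
  (tau : nat -> Omega -> R) (T : R) (q : 'I_N -> R)
  (UH : class_UH P sigma tau T q) (sw : switching_instants sigma tau)
  (mu : R) (lambda : 'I_N -> R) (mu0 : 0 <= mu).

Let theta := \sum_(j < N) mu * q j * mean_decay (lambda j) T.
Let eta := jump_factor sigma tau mu lambda.

(** Distributing the product over the sums in [jump_factorE] leaves, for each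
sequence of values, the expectation computed by [expectation_value_path];
distributing back gives the power. *)
Lemma expectation_jump_product (a m : nat) : (0 < a)%N ->
  (\int[P]_w (\prod_(i < m) eta (a + i) w)%:E = (theta ^+ m)%:E)%E.
Proof.
move=> a0.
pose G (i : 'I_m) (j : 'I_N) w :=
  \1_[set w | switched_value sigma tau (a + i) w = j] w
    * expR (- (lambda j * holding_time tau (a + i) w)) : R.
have mG (jj : {ffun 'I_m -> 'I_N}) :
    measurable_fun setT (fun w => \prod_(i < m) G i (jj i) w).
  apply: measurable_prod => i _; apply: measurable_funM.
    by apply: measurable_indic; exact: UH2_measurable UH _ _.
  apply: measurableT_comp => //; apply: measurableT_comp => //.
  by apply: measurable_funM => //; exact: (measurable_holding_time sw).
have G0 i j w : 0 <= G i j w by apply: mulr_ge0; [rewrite indicE ler0n|exact: expR_ge0].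
transitivity (\int[P]_w (\sum_(jj <- index_enum {ffun 'I_m -> 'I_N})
    (mu ^+ m)%:E * (\prod_(i < m) G i (jj i) w)%:E))%E.
  apply: eq_integral => w _.
  under [X in X%:E]eq_bigr do rewrite /eta jump_factorE.
  rewrite bigA_distr_bigA -sumEFin; apply: eq_bigr => jj _.
  rewrite -EFinM; congr _%:E.
  under eq_bigr do rewrite mulrCA.
  by rewrite big_split/= prodr_const card_ord.
rewrite ge0_integral_sum//; first last.
- by move=> jj w _; rewrite mule_ge0 ?lee_fin ?exprn_ge0 ?prodr_ge0.
- move=> jj; apply: emeasurable_funM => //.
  by apply/measurable_EFinP; exact: mG.
transitivity (\sum_(jj <- index_enum {ffun 'I_m -> 'I_N})
    (\prod_(i < m) (mu * q (jj i) * mean_decay (lambda (jj i)) T))%:E)%E.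
  apply: eq_bigr => jj _; rewrite ge0_integralZl//.
  - rewrite (expectation_value_path UH sw)// -EFinM; congr _%:E.
    under [RHS]eq_bigr do rewrite -mulrA.
    by rewrite [RHS]big_split/= prodr_const card_ord.
  - by apply/measurable_EFinP; exact: mG.
  - by move=> w _; rewrite lee_fin prodr_ge0.
  - by rewrite lee_fin exprn_ge0.
rewrite sumEFin -(bigA_distr_bigA (fun i j => mu * q j * mean_decay (lambda j) T)).
by rewrite prodr_const card_ord.
Qed.

Lemma jump_factor_ge0 i w : 0 <= eta i w.
Proof. by apply: mulr_ge0 => //; exact: expR_ge0. Qed.

Lemma holding_time_ge0 i w : 0 <= holding_time tau i w.
Proof. by case: sw => _ _ + _; rewrite subr_ge0. Qed.

Lemma holding_time_le_ae :
  {ae P, forall w, forall i, holding_time tau i w <= T}.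
Proof.
apply/ae_foralln => i.
exists (holding_time tau i @^-1` `]T, +oo[); split.
- rewrite -[X in measurable X]setTI.
  by apply: (measurable_holding_time sw i) => //; exact: measurable_itv.
- apply: (etrans (UH1_uniform UH i (measurable_itv `]T, +oo[))).
  rewrite /uniform_prob integral_uniform_pdf.
  rewrite (_ : _ `&` _ = set0) ?integral_set0// -subset0 => t [/=].
  by rewrite !in_itv/= andbT => Tt /andP[_ tT]; move: (lt_le_trans Tt tT); rewrite ltxx.
- by move=> w /= /negP; rewrite -ltNge in_itv/= andbT.
Qed.

(** Solution of u_(i+1) = eta_(i+1) u_i + K with u_0 = K0 + K.  The factors
start at eta_1. *)
Definition unrolled_bound (K0 K : R) (nu : nat) (w : Omega) : R :=
  K0 * \prod_(i < nu) eta (1 + i) w +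
  K * \sum_(l < nu.+1) \prod_(i < nu - l) eta (l.+1 + i) w.

Lemma unrolled_boundS K0 K nu w :
  unrolled_bound K0 K nu.+1 w = eta nu.+1 w * unrolled_bound K0 K nu w + K.
Proof.
rewrite /unrolled_bound big_ord_recr/= [X in _ + _ * X]big_ord_recr/=.
rewrite subnn big_ord0.
have -> : \sum_(l < nu.+1) \prod_(i < nu.+1 - l) eta (l.+1 + i) w =
  eta nu.+1 w * \sum_(l < nu.+1) \prod_(i < nu - l) eta (l.+1 + i) w.
  rewrite mulr_sumr; apply: eq_bigr => l _.
  have ln : (l <= nu)%N by rewrite -ltnS.
  by rewrite subSn// big_ord_recr/= mulrC addSn subnKC.
rewrite add1n; ring.
Qed.

Lemma unrolled_bound_ge0 K0 K nu w :
  0 <= K0 -> 0 <= K -> 0 <= unrolled_bound K0 K nu w.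
Proof.
move=> K00 K0'; rewrite addr_ge0 ?mulr_ge0 ?sumr_ge0// ?prodr_ge0// => i _.
  exact: jump_factor_ge0.
by apply: prodr_ge0 => j _; exact: jump_factor_ge0.
Qed.

Lemma measurable_prod_jump a m :
  measurable_fun setT (fun w => \prod_(i < m) eta (a + i) w).
Proof. by apply: measurable_prod => i _; exact: measurable_jump_factor UH sw _ _ _. Qed.

Lemma measurable_unrolled_bound K0 K nu :
  measurable_fun setT (unrolled_bound K0 K nu).
Proof.
apply: measurable_funD; apply: measurable_funM => //.
  exact: measurable_prod_jump.
by apply: measurable_sum => l; exact: measurable_prod_jump.
Qed.

Lemma expectation_unrolled_bound K0 K nu : 0 <= K0 -> 0 <= K ->
  (\int[P]_w (unrolled_bound K0 K nu w)%:E =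
   (K0 * theta ^+ nu + K * \sum_(l < nu.+1) theta ^+ (nu - l))%:E)%E.
Proof.
move=> K00 K0'.
have pr0 a m w : (0 <= (\prod_(i < m) eta (a + i) w)%:E)%E.
  by rewrite lee_fin prodr_ge0// => i _; exact: jump_factor_ge0.
have mpr a m : measurable_fun setT (fun w => (\prod_(i < m) eta (a + i) w)%:E).
  by apply/measurable_EFinP; exact: measurable_prod_jump.
transitivity (\int[P]_w (K0%:E * (\prod_(i < nu) eta (1 + i) w)%:E +
    K%:E * (\sum_(l <- index_enum 'I_nu.+1) (\prod_(i < nu - l) eta (l.+1 + i) w)%:E)))%E.
  by apply: eq_integral => w _; rewrite sumEFin -!EFinM -EFinD.
have s0 w : (0 <= \sum_(l <- index_enum 'I_nu.+1) (\prod_(i < nu - l) eta (l.+1 + i) w)%:E)%E.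
  by apply: sume_ge0 => l _; exact: pr0.
have ms : measurable_fun setT (fun w => \sum_(l <- index_enum 'I_nu.+1)
    (\prod_(i < nu - l) eta (l.+1 + i) w)%:E)%E.
  by apply: emeasurable_sum => l; exact: mpr.
rewrite ge0_integralD//; first last.
- by apply: emeasurable_funM => //; exact: measurable_cst.
- by move=> w _; rewrite mule_ge0.
- by apply: emeasurable_funM => //; exact: measurable_cst.
- by move=> w _; rewrite mule_ge0.
rewrite !ge0_integralZl// ge0_integral_sum//.
rewrite expectation_jump_product// EFinD !EFinM -sumEFin; congr (_ + _ * _)%E.
by apply: eq_bigr => l _; exact: expectation_jump_product.
Qed.

End UH.

(** * From the pathwise estimate to the expectation *)

Lemma switching_instant_ge0 (R : realType) (dO : measure_display)
    (Omega : measurableType dO) (N : nat) (sigma : R -> Omega -> 'I_N)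
    (tau : nat -> Omega -> R) (i : nat) (w : Omega) :
  switching_instants sigma tau -> 0 <= tau i w.
Proof.
move=> [_ tau0 tauS _]; elim: i => [|i IH]; first by rewrite tau0.
exact: le_trans IH (tauS i w).
Qed.

(** On a holding interval the signal is constant, so a solution follows a
single subsystem there, at almost every time with a disturbance bounded by
Delta. *)
Lemma decay_between_switches (R : realType) (dO : measure_display)
    (Omega : measurableType dO) (N n k : nat) (sigma : R -> Omega -> 'I_N)
    (tau : nat -> Omega -> R) (F : 'I_N -> 'rV[R]_n -> 'rV[R]_k -> 'rV[R]_n)
    (V : 'I_N -> 'rV[R]_n -> R) (lambda : 'I_N -> R) (chi : R -> R) (Delta : R)
    (d : R -> 'rV[R]_k) (x0 : 'rV[R]_n) (x : R -> Omega -> 'rV[R]_n) i w :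
  switching_instants sigma tau ->
  (forall j, Ck_on 1 setT (V j)) -> (forall j y, 0 <= V j y) ->
  (forall j, 0 <= lambda j) -> class_K chi -> 0 <= Delta ->
  (forall j y e, 'd (V j) y (F j y e) <= - lambda j * V j y + chi (enorm e)) ->
  {ae (@lebesgue_measure R), forall t : R, 0 <= t -> enorm (d t) <= Delta} ->
  is_solution sigma F d x0 x ->
  forall j, j = switched_value sigma tau i w ->
  V j (x (tau i.+1 w) w) <=
    expR (- (lambda j * holding_time tau i w)) * V j (x (tau i w) w)
    + chi Delta * holding_time tau i w.
Proof.
move=> sw V1 V0 l0 chiK D0 diss dD [_ _ xac xode] j jE.
have t0 := switching_instant_ge0 i w sw.
case: sw => _ _ tauS sigc.
have bad : {ae (@lebesgue_measure R), forall t : R,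
    (0 <= t -> enorm (d t) <= Delta) /\
    (0 <= t -> is_derive t 1 (x ^~ w) (F (sigma t w) (x t w) (d t)))}.
  have lf := ae_filter_ringOfSetsType (@lebesgue_measure R).
  exact: (filterI dD (xode w)).
apply: (lyapunov_decay (x := x ^~ w) (xdot := fun t => F (sigma t w) (x t w) (d t))
  (V1 j) (V0 j) (tauS i w) (l0 j) _ _ bad).
- by apply: class_K_ge0.
- by apply: xac.
move=> t /andP[tt tt'] /contrapT [td tode].
have tge0 : 0 <= t by exact: le_trans t0 tt.
split; first exact: tode.
rewrite (sigc i) ?tt//  -/(switched_value sigma tau i w) -jE; apply: le_trans (diss _ _ _) _.
by rewrite lerD2l; apply: class_K_le => //; [exact: enorm_ge0|exact: td].
Qed.

Lemma ess_sup_norm_ae_bound (R : realType) (k : nat) (d : R -> 'rV[R]_k) :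
  (ess_sup_norm `[0%R, +oo[%classic d < +oo)%E ->
  0 <= fine (ess_sup_norm `[0%R, +oo[%classic d) /\
  {ae (@lebesgue_measure R), forall t : R, 0 <= t ->
    enorm (d t) <= fine (ess_sup_norm `[0%R, +oo[%classic d)}.
Proof.
set S := ess_sup_norm _ _ => Soo.
have S0 : (0 <= S)%E.
  apply: ess_sup_gee.
    have := lebesgue_measure_itv (Interval -oo%O +oo%O : interval R) => /=.
    by rewrite set_itvNyy => ->; rewrite addye// ltry.
  have lf := ae_filter_ringOfSetsType (@lebesgue_measure R).
  apply: nearW => t; rewrite patchE; case: ifP => // _.
  by rewrite lee_fin enorm_ge0.
split; first exact: fine_ge0.
have lf := ae_filter_ringOfSetsType (@lebesgue_measure R).
have := @ess_sup_ge _ _ _ (@lebesgue_measure R)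
  ((fun t => (enorm (d t))%:E) \_ `[0%R, +oo[%classic).
apply: filterS => t H t0; rewrite -lee_fin fineK ?ge0_fin_numE//.
by move: H; rewrite patchE mem_set//= in_itv/= t0.
Qed.

(** The bound is shifted by one: the first step uses eta_0 <= mu, after which
only the factors eta_i with i > 0 occur. *)
Lemma jump_recursion_bound (R : realType) (dO : measure_display)
    (Omega : measurableType dO) (N : nat)
    (sigma : R -> Omega -> 'I_N) (tau : nat -> Omega -> R) (T : R)
    (mu : R) (lambda : 'I_N -> R) (C K0 : R) (w : Omega)
    (v : nat -> R) :
  switching_instants sigma tau -> 0 <= mu -> 0 <= C ->
  (forall j, 0 <= lambda j) -> (forall i, holding_time tau i w <= T) ->
  0 <= v 0%N <= K0 ->
  (forall i, v i.+1 <= jump_factor sigma tau mu lambda i w * v i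
                       + mu * C * holding_time tau i w) ->
  forall nu, v nu.+1 <= unrolled_bound sigma tau mu lambda (mu * K0) (mu * C * T) nu w.
Proof.
move=> sw mu0 C0 l0 ST /andP[v0 vK] rec.
have muC0 : 0 <= mu * C by exact: mulr_ge0.
have SC i : mu * C * holding_time tau i w <= mu * C * T by exact: ler_wpM2l.
elim=> [|nu IH]; apply: (le_trans (rec _)).
  rewrite /unrolled_bound big_ord0 big_ord1 big_ord0 !mulr1 lerD//.
  apply: ler_pM => //; first exact: (jump_factor_ge0 _ _ _ mu0).
  rewrite -[leRHS]mulr1; apply: ler_wpM2l => //.
  rewrite -expR0 ler_expR oppr_le0 mulr_ge0//.
  exact: (holding_time_ge0 sw).
rewrite unrolled_boundS lerD// ler_wpM2l//.
exact: (jump_factor_ge0 _ _ _ mu0).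
Qed.

Lemma geometric_sum_le (R : realType) (theta rho : R) (nu : nat) :
  0 <= theta <= rho -> rho < 1 ->
  \sum_(l < nu.+1) theta ^+ (nu - l) <= (1 - rho)^-1.
Proof.
move=> /andP[t0 tr] r1; have r0 : 0 <= rho by exact: le_trans t0 tr.
have -> : \sum_(l < nu.+1) theta ^+ (nu - l) = \sum_(l < nu.+1) theta ^+ l.
  by rewrite [RHS](reindex_inj rev_ord_inj)/=; apply: eq_bigr => l _; rewrite subSS.
rewrite -[leRHS]mul1r ler_pdivlMr ?subr_gt0//.
have h : (\sum_(l < nu.+1) theta ^+ l) * (1 - theta) <= 1.
  have := subrX1 theta nu.+1; have := exprn_ge0 nu.+1 t0; rewrite mulrC; lra.
apply: le_trans h; apply: ler_wpM2l; last by rewrite lerB.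
by apply: sumr_ge0 => l _; exact: exprn_ge0.
Qed.

Theorem proposition9
  (R : realType) (dO : measure_display) (Omega : measurableType dO)
  (P : probability Omega R) (N n k m : nat)
  (f : 'I_N -> 'rV[R]_n -> 'rV[R]_k -> 'rV[R]_n)
  (g : 'I_N -> 'I_m -> 'rV[R]_n -> 'rV[R]_n)
  (f_smooth : forall j,
     smooth_on setT (fun p : 'rV[R]_n * 'rV[R]_k => f j p.1 p.2))
  (g_smooth : forall j i, smooth_on setT (g j i))
  (sigma : R -> Omega -> 'I_N) (tau : nat -> Omega -> R)
  (sigma_switching : random_switching_signal sigma)
  (tau_switching : switching_instants sigma tau)
  (T : R) (q : 'I_N -> R)
  (sigma_UH : class_UH P sigma tau T q)
  (V : 'I_N -> 'rV[R]_n -> R)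
  (V_ge0 : forall j x, 0 <= V j x)
  (V_C1 : forall j, Ck_on 1 setT (V j))
  (alpha1 alpha2 : R -> R)
  (alpha1_Koo : class_Koo alpha1) (alpha2_Koo : class_Koo alpha2)
  (Cd1 : forall j x, alpha1 (enorm x) <= V j x <= alpha2 (enorm x))
  (mu : R) (mu_ge1 : 1 <= mu)
  (Cd2 : forall i j x, V i x <= mu * V j x)
  (chi : R -> R) (chi_Koo : class_Koo chi) (lambda : 'I_N -> R)
  (Cd3 : forall j x (d : 'rV[R]_k), x != 0 ->
     (ereal_inf [set ('d (V j) x (f j x d) + 3 * lambda j * V j x
                      + \sum_(i < m) lie_derivative (g j i) (V j) x * u ord0 i)%:E
                | u in [set: 'rV[R]_m]] <= (chi (enorm d))%:E)%E)
  (max_exists : forall j x,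
     has_max_value (fun d : 'rV[R]_k => 'd (V j) x (f j x d) - chi (enorm d)))
  (Cd4 : forall eps : R, 0 < eps -> exists2 delta : R, 0 < delta &
     forall x : 'rV[R]_n, x != 0 -> enorm x < delta ->
     exists2 u : 'rV[R]_m, enorm u < eps &
     forall j, max_value (fun d : 'rV[R]_k => 'd (V j) x (f j x d) - chi (enorm d))
       + \sum_(i < m) lie_derivative (g j i) (V j) x * u ord0 i
       <= - lambda j * V j x)
  (Cd5 : \sum_(j < N) mu * q j * mean_decay (lambda j) T < 1)
  (Wtilde : 'I_N -> 'rV[R]_n -> 'rV[R]_m)
  (Wtilde_def : forall j x,
     Wtilde j x = \row_(i < m) lie_derivative (g j i) (V j) x)
  (Wbar : 'I_N -> 'rV[R]_n -> R)
  (Wbar_smooth : forall j, smooth_on [set x | x != 0] (Wbar j))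
  (Wbar_cont0 : forall j, {for 0, continuous (Wbar j)})
  (Wbar_bounds : forall j x,
     max_value (fun d : 'rV[R]_k => 'd (V j) x (f j x d) - chi (enorm d))
       + lambda j * V j x <= Wbar j x
     <= max_value (fun d : 'rV[R]_k => 'd (V j) x (f j x d) - chi (enorm d))
       + 2 * lambda j * V j x) :
  ISS_L1_at_switching_instants P sigma tau
    (fun j x d => affine_dynamics f g j x d (sontag (Wbar j x) (Wtilde j x))).

Proof.
have T0 := UH_T_gt0 sigma_UH.
pose theta := \sum_(j < N) mu * q j * mean_decay (lambda j) T.
have mu0 : 0 < mu by exact: lt_le_trans ltr01 mu_ge1.
have q0 j : 0 <= q j by have /andP[/ltW] := UH_q_itv sigma_UH j.
have theta0 : 0 <= theta.
  apply: sumr_ge0 => j _; apply: mulr_ge0; last exact: mean_decay_ge0.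
  by apply: mulr_ge0 => //; exact: ltW.
(* The maximum with 1/2 makes rho positive, so that ln rho is meaningful. *)
pose rho := Num.max theta 2^-1.
have tr : theta <= rho by rewrite le_max lexx.
have rho0 : 0 < rho by rewrite lt_max invr_gt0 ltr0n orbT.
have rho1 : rho < 1 by rewrite gt_max Cd5/= invf_lt1 ?ltr1n ?ltr0n.
have chiK := chi_Koo.1; have a2K := alpha2_Koo.1.
exists (fun r s => mu * expR ((s - 1) * ln rho) * alpha2 r), alpha1,
  (fun r => mu * T / (1 - rho) * chi r); split => //.
- by apply: class_KL_geometric => //; rewrite rho0.
- apply: class_Koo_scale => //; apply: divr_gt0; last by rewrite subr_gt0.
  exact: mulr_gt0.
move=> x0 d x x0n0 [_ dfin] sol nu nu0.
have [D0 dD] := ess_sup_norm_ae_bound dfin.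
set Delta := fine _ in D0 dD *.
have C0 : 0 <= chi Delta by exact: class_K_ge0.
have l0 j : 0 <= lambda j.
  have Vx0 : 0 < V j x0.
    have /andP[+ _] := Cd1 j x0; apply: lt_le_trans.
    by apply: class_K_gt0 alpha1_Koo.1 _; exact: enorm_gt0.
  have /andP[h1 h2] := Wbar_bounds j x0.
  have : 0 <= lambda j * V j x0 by lra.
  by rewrite pmulr_lge0.
have V00 j : V j 0 = 0.
  apply/eqP; rewrite eq_le V_ge0 andbT.
  have /andP[_ +] := Cd1 j 0; rewrite enorm0.
  by case: a2K => _ _ _ ->.
have diss j y e : 'd (V j) y (affine_dynamics f g j y e (sontag (Wbar j y) (Wtilde j y)))
    <= - lambda j * V j y + chi (enorm e).
  (* Cd3 is assumed only away from 0; at 0 the differential of V_j vanishes. *)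
  have [->|y0] := eqVneq y 0.
    rewrite diff_at_min.
    - by rewrite V00 mulr0 add0r; apply: class_K_ge0 => //; exact: enorm_ge0.
    - by move=> z; exact: C1_differentiable.
    - by move=> z; rewrite V00.
  apply: sontag_dissipation => //.
  - by move=> e'; exact: Cd3.
  - by have /andP[] := Wbar_bounds j y.
pose J i w := switched_value sigma tau i w.
pose v w i := V (J i w) (x (tau i w) w).
have [_ x00 _ _] := sol; have [_ tau0 _ _] := tau_switching.
have vrec w i : v w i.+1 <= jump_factor sigma tau mu lambda i w * v w i
    + mu * chi Delta * holding_time tau i w.
  have dec := decay_between_switches (i := i) (w := w) tau_switching V_C1 V_ge0
    l0 chiK D0 diss dD sol erefl.
  apply: (le_trans (Cd2 _ (J i w) _)).
  by rewrite /jump_factor -!mulrA -mulrDr ler_wpM2l// ltW.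
have vK w : 0 <= v w 0%N <= alpha2 (enorm x0).
  by rewrite /v V_ge0 tau0 x00; have /andP[] := Cd1 (J 0%N w) x0.
case: nu nu0 => // nu _.
pose K0 := mu * alpha2 (enorm x0); pose K := mu * chi Delta * T.
have mu0' := ltW mu0; have T0' := ltW T0.
have a20 : 0 <= alpha2 (enorm x0) by apply: class_K_ge0 => //; exact: enorm_ge0.
have K00 : 0 <= K0 by exact: mulr_ge0.
have K0' : 0 <= K by rewrite /K !mulr_ge0.
rewrite unlock.
apply: (@le_trans _ _ (\int[P]_w (unrolled_bound sigma tau mu lambda K0 K nu w)%:E)%E).
  apply: integral_le_ae_majorant.
  - move=> w; rewrite lee_fin; apply: class_K_ge0 alpha1_Koo.1 _; exact: enorm_ge0.
  - by move=> w; rewrite lee_fin; apply: unrolled_bound_ge0 => //; exact: ltW.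
  - by apply/measurable_EFinP; exact: (measurable_unrolled_bound sigma_UH tau_switching).
  have := holding_time_le_ae sigma_UH tau_switching.
  apply: filterS => w ST; rewrite lee_fin.
  have /andP[+ _] := Cd1 (J nu.+1 w) (x (tau nu.+1 w) w).
  move=> /le_trans; apply.
  exact: (jump_recursion_bound tau_switching mu0' C0 l0 ST (vK w) (vrec w)).
rewrite (expectation_unrolled_bound sigma_UH tau_switching _ (ltW mu0))// lee_fin -/theta.
apply: lerD.
  have -> : nu.+1%:R - 1 = nu%:R :> R by rewrite -natr1 addrK.
  rewrite expRM_natl lnK ?posrE// /K0 mulrAC; apply: ler_wpM2r => //.
  by apply: ler_wpM2l => //; apply: lerXn2r; rewrite ?nnegrE// ltW.
have /(geometric_sum_le nu)/(_ rho1) gs : 0 <= theta <= rho by rewrite theta0.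
rewrite /K [leRHS](_ : _ = mu * chi Delta * T * (1 - rho)^-1); last by ring.
exact: ler_wpM2l.
Qed.
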